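(* Let $\varphi:\mathbb{R}^n\to\mathbb{R}$ be of class $\mathcal C^{1,1}$ on a neighborhood of $\bar x$, where $\bar x$ is a tilt-stable local minimizer of $\varphi$ with modulus $\kappa>0$, and let $\bar v=0$. Then: (i) There exists $\delta>0$ such that for any $(x,v)\in\operatorname{gph}\nabla\varphi\cap\mathbb B_\delta(\bar x,\bar v)$ and any $q$ with $v-\bar v\in D\nabla\varphi(x)(q)$ there is a matrix $A\in\operatorname{co}\overline\nabla^2\varphi(x)$ with $\|x-\bar x-q\|\le\kappa\|\nabla\varphi(x)-\nabla\varphi(\bar x)-A(x-\bar x)\|$. Similarly, there exists $\delta>0$ such that for any $(x,v)\in\operatorname{gph}\nabla\varphi\cap\mathbb B_\delta(\bar x,\bar v)$ and any $q$ with $\bar v-v\in D\nabla\varphi(x)(q)$ there is $A\in\operatorname{co}\overline\nabla^2\varphi(x)$ with $\|x-\bar x+q\|\le\kappa\|\nabla\varphi(x)-\nabla\varphi(\bar x)-A(x-\bar x)\|$. (ii) If in addition $\nabla\varphi$ is semidifferentiable at every point of a neighborhood of $\bar x$, then there exists $\delta>0$ such that for any $(x,v)\in\operatorname{gph}\nabla\varphi\cap\mathbb B_\delta(\bar x,\bar v)$ and any $q$ with $v-\bar v\in D\nabla\varphi(x)(q)$ we have $\|x-\bar x-q\|\le\kappa\|\nabla\varphi(x)-\nabla\varphi(\bar x)-D\nabla\varphi(x)(x-\bar x)\|$ (here $D\nabla\varphi(x)$ is single-valued).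
   Context: $\mathcal C^{1,1}$ near $\bar x$: differentiable with locally Lipschitz gradient near $\bar x$. Tangent cone $T_\Omega(\bar x)=\{w:\exists t_k\downarrow0,w_k\to w,\bar x+t_kw_k\in\Omega\}$; for single-valued $f$, the graphical derivative is $Df(x)(u)=\{w:(u,w)\in T_{\operatorname{gph}f}(x,f(x))\}$. $\overline\nabla^2\varphi(x)$ is the set of all limits $\lim\nabla(\nabla\varphi)(x_k)$ with $x_k\to x$ and $\nabla\varphi$ differentiable at $x_k$; $\operatorname{co}$ is convex hull. A mapping $h$ is semidifferentiable at $x$ if there is a continuous positively homogeneous $H$ with $h(z)=h(x)+H(z-x)+o(\|z-x\|)$. $\bar x$ is a tilt-stable local minimizer of $\varphi$ with modulus $\kappa>0$ if for some $\gamma>0$ the mapping $M_\gamma(v)=\operatorname{argmin}\{\varphi(x)-\langle v,x\rangle:x\in\mathbb B_\gamma(\bar x)\}$ is single-valued and Lipschitz continuous with constant $\kappa$ on a neighborhood of $0$, with $M_\gamma(0)=\{\bar x\}$. *)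

(* Defs.v *)
From HB Require Import structures.
From mathcomp Require Import all_boot all_order all_algebra.
From mathcomp Require Import reals.
Set Implicit Arguments. Unset Strict Implicit. Unset Printing Implicit Defensive.
Import Order.TTheory GRing.Theory Num.Theory.
Local Open Scope ring_scope.

Section Defs.
Variables (R : realType) (n : nat).
Local Notation V := 'rV[R]_n.

Definition dotv (u v : V) : R := \sum_(i < n) u 0 i * v 0 i.
Definition enorm (u : V) : R := Num.sqrt (dotv u u).

Definition mxnorm (A : 'M[R]_n) : R :=
  Num.sqrt (\sum_(i < n) \sum_(j < n) A i j ^+ 2).

Definition mxapp (A : 'M[R]_n) (u : V) : V := u *m A^T.

Definition seq_cvg (u : nat -> V) (l : V) : Prop :=
  forall eps : R, 0 < eps -> exists N : nat, forall k, (N <= k)%N -> enorm (u k - l) < eps.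
Definition rseq_cvg (t : nat -> R) (l : R) : Prop :=
  forall eps : R, 0 < eps -> exists N : nat, forall k, (N <= k)%N -> `|t k - l| < eps.
Definition mseq_cvg (A : nat -> 'M[R]_n) (L : 'M[R]_n) : Prop :=
  forall eps : R, 0 < eps -> exists N : nat, forall k, (N <= k)%N -> mxnorm (A k - L) < eps.

Definition has_gradient (f : V -> R) (x g : V) : Prop :=
  forall eps : R, 0 < eps -> exists d : R, 0 < d /\
    forall z, enorm (z - x) < d -> `|f z - f x - dotv g (z - x)| <= eps * enorm (z - x).

Definition has_jacobian (h : V -> V) (x : V) (J : 'M[R]_n) : Prop :=
  forall eps : R, 0 < eps -> exists d : R, 0 < d /\
    forall z, enorm (z - x) < d -> enorm (h z - h x - mxapp J (z - x)) <= eps * enorm (z - x).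

Definition C11_near (phi : V -> R) (gphi : V -> V) (xb : V) : Prop :=
  exists r : R, 0 < r /\
    (forall x, enorm (x - xb) < r -> has_gradient phi x (gphi x)) /\
    exists L : R, forall x y, enorm (x - xb) < r -> enorm (y - xb) < r ->
      enorm (gphi x - gphi y) <= L * enorm (x - y).

(* graphical derivative: w \in Dh(x)(u), i.e. (u,w) \in T_{gph h}(x, h x) *)
Definition graph_deriv (h : V -> V) (x u w : V) : Prop :=
  exists (t : nat -> R) (uk wk : nat -> V),
    (forall k, 0 < t k) /\ rseq_cvg t 0 /\ seq_cvg uk u /\ seq_cvg wk w /\
    forall k, h (x + t k *: uk k) = h x + t k *: wk k.

Definition gen_hessian (gphi : V -> V) (x : V) (A : 'M[R]_n) : Prop :=
  exists (xk : nat -> V) (Jk : nat -> 'M[R]_n),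
    seq_cvg xk x /\ (forall k, has_jacobian gphi (xk k) (Jk k)) /\ mseq_cvg Jk A.

Definition conv_hull (S : 'M[R]_n -> Prop) (A : 'M[R]_n) : Prop :=
  exists (m : nat) (lam : 'I_m -> R) (B : 'I_m -> 'M[R]_n),
    (forall i, 0 <= lam i) /\ \sum_(i < m) lam i = 1 /\ (forall i, S (B i)) /\
    A = \sum_(i < m) lam i *: B i.

Definition semidiff (h : V -> V) (x : V) : Prop :=
  exists H : V -> V,
    (forall u eps, 0 < eps -> exists d : R, 0 < d /\
       forall u', enorm (u' - u) < d -> enorm (H u' - H u) < eps) /\
    (forall (t : R) u, 0 < t -> H (t *: u) = t *: H u) /\
    (forall eps : R, 0 < eps -> exists d : R, 0 < d /\
       forall z, enorm (z - x) < d -> enorm (h z - h x - H (z - x)) <= eps * enorm (z - x)).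

Definition is_tilt_argmin (phi : V -> R) (xb : V) (gamma : R) (v x : V) : Prop :=
  enorm (x - xb) <= gamma /\
  forall y, enorm (y - xb) <= gamma -> phi x - dotv v x <= phi y - dotv v y.

Definition tilt_stable (phi : V -> R) (xb : V) (kappa : R) : Prop :=
  exists gamma : R, 0 < gamma /\ exists eps : R, 0 < eps /\ exists M : V -> V,
    (forall v, enorm v < eps -> forall x, is_tilt_argmin phi xb gamma v x <-> x = M v) /\
    (forall v v', enorm v < eps -> enorm v' < eps -> enorm (M v - M v') <= kappa * enorm (v - v')) /\
    M 0 = xb.

Definition in_ball2 (xb vb : V) (delta : R) (x v : V) : Prop :=
  enorm (x - xb) ^+ 2 + enorm (v - vb) ^+ 2 <= delta ^+ 2.

End Defs.

(* Main.v *)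
Require Import Defs.
From HB Require Import structures.
From mathcomp Require Import all_boot all_order all_algebra.
From mathcomp Require Import all_classical all_reals all_analysis measurable_realfun.
From mathcomp Require Import ring lra.
Set Implicit Arguments. Unset Strict Implicit. Unset Printing Implicit Defensive.
Import Order.TTheory GRing.Theory Num.Theory.
Import numFieldNormedType.Exports.
Local Open Scope classical_set_scope.
Local Open Scope ring_scope.

(** Tilt stability makes the gradient strongly monotone near [xb]: the argmin map [M] is the
    kappa-Lipschitz gradient of a convex conjugate, whose descent inequality is a quadratic
    growth condition on [phi], and [M] covers a neighborhood of [xb]. Part (ii) is the
    resulting bound |x - y| <= kappa |g x - g y| passed to the limit. For part (i), write
    w for the value of the graphical derivative at q, and p for q - (x - xb). Rademacher's
    theorem on lines parallel to q gives Jacobians J of g arbitrarily close to x with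
    <p, J q> <= <p, w> + o(1); a limit A of them satisfies <p, A q> <= <p, w> and
    <p, A p> >= |p|^2 / kappa, and these two inequalities give the claim. Thus a single
    generalized Hessian suffices, without taking convex combinations. *)

(** * Euclidean norm *)

(** One Hessian is enough because of the order of quantifiers: the test vector p is fixed before any
    Jacobian is chosen, so a scalar mean value inequality suffices, whereas asking for A q = w would
    in general force a convex combination. The segment issued from x along q may consist of points
    where the gradient has no Jacobian, so it is traded for a nearby, slightly sheared one. Null
    sets are therefore needed in two ways: proving Rademacher's theorem starts from smallness on
    every line of one direction, and using it requires one good line in a prescribed direction.
    Iterated shadows give both. The modulus must come out as exactly [kappa]: reading the growth of
    the conjugate directly off the Lipschitz bound on the argmin map loses a factor 2, hence the
    refinement by bisection. Finally, the gradient is Lipschitz only near [xb], so it is first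
    composed with a projection onto a small cube; the radius [rho / (n + 1)] of part (i) comes from
    there. *)

Section Euclid.
Variables (R : realType) (n : nat).
Implicit Types (u v w : 'rV[R]_n) (a : R).

Lemma dotvC u v : dotv u v = dotv v u.
Proof. by apply: eq_bigr => i _; rewrite mulrC. Qed.

Lemma dotvDl u v w : dotv (u + v) w = dotv u w + dotv v w.
Proof. by rewrite -big_split; apply: eq_bigr => i _; rewrite mxE mulrDl. Qed.

Lemma dotvDr u v w : dotv u (v + w) = dotv u v + dotv u w.
Proof. by rewrite dotvC dotvDl !(dotvC u). Qed.

Lemma dotvZl a u v : dotv (a *: u) v = a * dotv u v.
Proof. by rewrite mulr_sumr; apply: eq_bigr => i _; rewrite mxE mulrA. Qed.

Lemma dotvZr a u v : dotv u (a *: v) = a * dotv u v.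
Proof. by rewrite dotvC dotvZl dotvC. Qed.

Lemma dotvNl u v : dotv (- u) v = - dotv u v.
Proof. by rewrite -scaleN1r dotvZl mulN1r. Qed.

Lemma dotvNr u v : dotv u (- v) = - dotv u v.
Proof. by rewrite dotvC dotvNl dotvC. Qed.

Lemma dotvBl u v w : dotv (u - v) w = dotv u w - dotv v w.
Proof. by rewrite dotvDl dotvNl. Qed.

Lemma dotvBr u v w : dotv u (v - w) = dotv u v - dotv u w.
Proof. by rewrite dotvDr dotvNr. Qed.

Definition dotvE := (dotvDl, dotvDr, dotvNl, dotvNr, dotvZl, dotvZr).

Lemma dotv0 u : dotv u 0 = 0.
Proof. by rewrite -(scale0r 0) dotvZr mul0r. Qed.

Lemma dot0v u : dotv 0 u = 0.
Proof. by rewrite dotvC dotv0. Qed.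

Lemma dotvv_ge0 u : 0 <= dotv u u.
Proof. by apply: sumr_ge0 => i _; rewrite -expr2 sqr_ge0. Qed.

Lemma dotvv_eq0 u : (dotv u u == 0) = (u == 0).
Proof.
apply/idP/eqP => [|->]; last by rewrite dotv0.
rewrite psumr_eq0 => [/allP h|i _]; last by rewrite -expr2 sqr_ge0.
apply/rowP => i; rewrite mxE; have /implyP := h i (mem_index_enum i).
by move=> /(_ isT); rewrite mulf_eq0 orbb => /eqP.
Qed.

Lemma sqr_enorm u : enorm u ^+ 2 = dotv u u.
Proof. by rewrite sqr_sqrtr ?dotvv_ge0. Qed.

Lemma enorm_ge0 u : 0 <= enorm u.
Proof. exact: sqrtr_ge0. Qed.

Lemma enorm0 : enorm (0 : 'rV[R]_n) = 0.
Proof. by rewrite /enorm dotv0 sqrtr0. Qed.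

Lemma enorm_eq0 u : (enorm u == 0) = (u == 0).
Proof. by rewrite -dotvv_eq0 -sqr_enorm expf_eq0. Qed.

Lemma enorm_gt0 u : (0 < enorm u) = (u != 0).
Proof. by rewrite lt_def enorm_ge0 andbT enorm_eq0. Qed.

Lemma enormZ a u : enorm (a *: u) = `|a| * enorm u.
Proof.
by rewrite /enorm dotvZl dotvZr mulrA -expr2 sqrtrM ?sqr_ge0// sqrtr_sqr.
Qed.

Lemma enormN u : enorm (- u) = enorm u.
Proof. by rewrite -scaleN1r enormZ normrN1 mul1r. Qed.

Lemma enormBC u v : enorm (u - v) = enorm (v - u).
Proof. by rewrite -enormN opprB. Qed.

Lemma dotv_le_enorm u v : dotv u v <= enorm u * enorm v.
Proof.
have [->|u0] := eqVneq u 0; first by rewrite dot0v enorm0 mul0r.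
have [->|v0] := eqVneq v 0; first by rewrite dotv0 enorm0 mulr0.
move: u0 v0; rewrite -!enorm_gt0 => u0 v0.
have := dotvv_ge0 (enorm v *: u - enorm u *: v).
rewrite !dotvE -!sqr_enorm (dotvC v u).
move: (enorm u) (enorm v) u0 v0 (dotv u v) => a b a0 b0 d h.
have : 0 <= (a * b) * (a * b - d) by nra.
by rewrite pmulr_rge0 ?mulr_gt0// subr_ge0.
Qed.

Lemma norm_dotv_le u v : `|dotv u v| <= enorm u * enorm v.
Proof.
rewrite ler_norml dotv_le_enorm andbT lerNl -dotvNl.
by rewrite -(enormN u) dotv_le_enorm.
Qed.

Lemma enormD u v : enorm (u + v) <= enorm u + enorm v.
Proof.
rewrite -(@ler_pXn2r _ 2) ?nnegrE ?addr_ge0 ?enorm_ge0//.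
rewrite sqr_enorm !dotvE (dotvC v u) -!sqr_enorm.
have := dotv_le_enorm u v; nra.
Qed.

Lemma enormB u v : enorm (u - v) <= enorm u + enorm v.
Proof. by rewrite -(enormN v) enormD. Qed.

Lemma enorm_dist w u v : enorm (u - v) <= enorm (u - w) + enorm (w - v).
Proof. by rewrite -{1}(subrK w u) -addrA enormD. Qed.

Lemma enorm_sum I (r : seq I) (P : pred I) (F : I -> 'rV[R]_n) :
  enorm (\sum_(i <- r | P i) F i) <= \sum_(i <- r | P i) enorm (F i).
Proof.
elim/big_rec2: _ => [|i y x _ h]; first by rewrite enorm0.
by apply: le_trans (enormD _ _) _; rewrite lerD2l.
Qed.

Lemma coord_le_enorm u i : `|u 0 i| <= enorm u.
Proof.
rewrite -sqrtr_sqr ler_wsqrtr// expr2 /dotv (bigD1 i)//= lerDl.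
by apply: sumr_ge0 => j _; rewrite -expr2 sqr_ge0.
Qed.

Lemma enorm_delta i : enorm (delta_mx 0 i : 'rV[R]_n) = 1.
Proof.
rewrite /enorm /dotv (bigD1 i)//= big1 => [|j ji]; rewrite mxE ?eqxx.
  by rewrite addr0 mulr1 sqrtr1.
by rewrite (negPf ji) mulr0.
Qed.

Lemma enorm_le_sum u : enorm u <= \sum_i `|u 0 i|.
Proof.
rewrite {1}(row_sum_delta u); apply: le_trans (enorm_sum _ _ _) _.
by apply: ler_sum => i _; rewrite enormZ enorm_delta mulr1.
Qed.

Lemma enorm_le_norm u : enorm u <= n%:R * `|u|.
Proof.
apply: le_trans (enorm_le_sum u) _.
have -> : n%:R * `|u| = \sum_(i < n) `|u| by rewrite sumr_const card_ord mulr_natl.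
apply: ler_sum => i _.
rewrite [leRHS]/Num.norm/= mx_normrE.
exact: (@le_bigmax _ _ _ _ (fun ij : 'I_1 * 'I_n => `|u ij.1 ij.2|) (0, i)).
Qed.

Lemma norm_le_enorm u : `|u| <= enorm u.
Proof.
rewrite [leLHS]/Num.norm/= mx_normrE.
apply/bigmax_leP; split=> [|[i j] _]; first exact: enorm_ge0.
by rewrite (ord1 i) coord_le_enorm.
Qed.

End Euclid.

(** * Compactness of Euclidean balls *)

Section EuclidCompact.
Variables (R : realType) (n : nat).
Implicit Types (u v w : 'rV[R]_n) (a : R).

(** The topology on row vectors is that of the sup norm, so the radius is divided by the equivalence
    constant; [n.+1] instead of [n] covers dimension 0. *)
Lemma enorm_ball_nbhs (x : 'rV[R]_n) (e : R) : 0 < e ->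
  nbhs x [set y : 'rV[R]_n | enorm (y - x) < e].
Proof.
move=> e0; apply/nbhs_ballP; exists (e / n.+1%:R) => [|y] /=.
  by rewrite divr_gt0.
rewrite -ball_normE/= => h.
rewrite enormBC; apply: le_lt_trans (enorm_le_norm _) _.
rewrite ltr_pdivlMr// mulrC in h; apply: le_lt_trans h.
by rewrite ler_wpM2r// ler_nat.
Qed.

Lemma compact_enorm_ball (a : R) : compact [set u : 'rV[R]_n | enorm u <= a].
Proof.
apply: bounded_closed_compact.
  exists a; split=> [|b ab u /= ua]; first exact: num_real.
  exact: le_trans (norm_le_enorm u) (le_trans ua (ltW ab)).
move=> u /= h; apply/ler_addgt0Pr => e e0.
have [v [/= va vu]] := h _ (enorm_ball_nbhs u e0).
apply: le_trans (_ : enorm v + enorm (v - u) <= _); last exact: lerD (ltW _).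
by have := enormB v (v - u); rewrite opprB addrC subrK.
Qed.

Lemma lipschitz_EVT_min (F : 'rV[R]_n -> R) (a C : R) : 0 <= a -> 0 < C ->
  (forall u v, enorm u <= a -> enorm v <= a -> `|F u - F v| <= C * enorm (u - v)) ->
  exists u, enorm u <= a /\ forall v, enorm v <= a -> F u <= F v.
Proof.
move=> a0 C0 FC.
have [|||c cA h] := @EVT_min_rV R n F [set u | enorm u <= a]%classic.
- by exists 0; rewrite /= enorm0.
- exact: compact_enorm_ball.
- apply/subspace_continuousP => x /= xa; apply/cvgrPdist_lt => e e0.
  near=> y; apply: le_lt_trans (FC _ _ xa _) _; first by near: y; exact: withinT.
  rewrite mulrC -ltr_pdivlMr// enormBC; near: y; apply: cvg_within.
  by apply: enorm_ball_nbhs; rewrite divr_gt0.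
- exists c; split=> [|v va]; first by move: cA; rewrite inE.
  by apply: h; rewrite inE.
Unshelve. all: end_near. Qed.
End EuclidCompact.

(** * Tilt stability and strong monotonicity of the gradient *)

Section Fermat.
Variables (R : realType) (n : nat).
Implicit Types (x v g : 'rV[R]_n).

Lemma has_gradient_min (phi : 'rV[R]_n -> R) x g v (r : R) : 0 < r ->
  has_gradient phi x g ->
  (forall y, enorm (y - x) < r -> phi x - dotv v x <= phi y - dotv v y) ->
  g = v.
Proof.
move=> r0 hg hmin; apply/eqP; rewrite -subr_eq0 -enorm_eq0; apply/negPn/negP => e0.
have {}e0 : 0 < enorm (g - v) by rewrite lt_def e0 enorm_ge0.
have [e he e0'] : exists2 e, dotv g e - dotv v e = enorm e ^+ 2 & 0 < enorm e.
  by exists (g - v); rewrite // -dotvBl sqr_enorm.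
move: e0' => {}e0.
(* Moving by [- s *: e] lowers the tilted function by [s * enorm e ^+ 2] to first order; precision
   [enorm e / 2] lets the remainder eat only half of that. *)
have [d [d0 hd]] := hg (enorm e / 2) (divr_gt0 e0 (ltr0Sn _ _)).
pose m := Num.min d r / 2.
have m0 : 0 < m by rewrite divr_gt0// lt_min d0 r0.
have [md mr] : m < d /\ m < r.
  have : 0 < Num.min d r by rewrite lt_min d0 r0.
  have : Num.min d r <= d by rewrite ge_min lexx.
  have : Num.min d r <= r by rewrite ge_min lexx orbT.
  by rewrite /m; lra.
pose s := m / enorm e.
have s0 : 0 < s by rewrite divr_gt0.
have zx : x - s *: e - x = - (s *: e) by rewrite addrAC subrr sub0r.
have nz : enorm (x - s *: e - x) = m.
  by rewrite zx enormN enormZ gtr0_norm// divfK// gt_eqF.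
have := hmin (x - s *: e); rewrite nz => /(_ mr).
have := hd (x - s *: e); rewrite nz => /(_ md); rewrite zx ler_norml => /andP[_].
rewrite !dotvE; have : m = s * enorm e by rewrite divfK// gt_eqF.
have := mulr_gt0 s0 (mulr_gt0 e0 e0).
move=> h1 -> h3 h4; have : s * (dotv g e - dotv v e) = s * enorm e ^+ 2 by rewrite he.
by rewrite expr2; lra.
Qed.
End Fermat.

Section Tilt.
Variables (R : realType) (n : nat) (phi : 'rV[R]_n -> R) (gphi : 'rV[R]_n -> 'rV[R]_n).
Variables (xb : 'rV[R]_n) (kappa gamma eps : R) (M : 'rV[R]_n -> 'rV[R]_n).
Hypothesis kappa0 : 0 < kappa.
Hypothesis eps0 : 0 < eps.
Hypothesis gamma0 : 0 < gamma.
Hypothesis Margmin : forall v, enorm v < eps -> is_tilt_argmin phi xb gamma v (M v).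
Hypothesis Mlip : forall v v', enorm v < eps -> enorm v' < eps ->
  enorm (M v - M v') <= kappa * enorm (v - v').

(* The conjugate of [phi] plus the indicator of the ball: it is convex, with gradient [M]. *)
Let psi v := dotv v (M v) - phi (M v).

Lemma conj_ge v x : enorm v < eps -> enorm (x - xb) <= gamma ->
  dotv v x - phi x <= psi v.
Proof. by move=> ve xg; have [_ /(_ x xg)] := Margmin ve; rewrite /psi; lra. Qed.

Lemma conj_subgrad v v' : enorm v < eps -> enorm v' < eps ->
  psi v' + dotv (v - v') (M v') <= psi v.
Proof.
move=> ve v'e; have [h _] := Margmin v'e.
by have := conj_ge ve h; rewrite dotvBl /psi; lra.
Qed.

Lemma conj_descent v v' : enorm v < eps -> enorm v' < eps ->
  psi v' <= psi v + dotv (v' - v) (M v) + kappa / 2 * enorm (v' - v) ^+ 2.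
Proof.
move=> ve v'e.
(* Splitting the segment at its midpoint turns the constant [C] into [C/2 + kappa/4],
   whose fixed point is [kappa/2]. *)
have key k : forall v v', enorm v < eps -> enorm v' < eps ->
    psi v' <= psi v + dotv (v' - v) (M v)
      + (kappa / 2 + kappa / 2 * 2^-1 ^+ k) * enorm (v' - v) ^+ 2.
  elim: k => [|k ih] {v v' ve v'e} v v' ve v'e.
    have := conj_subgrad ve v'e; rewrite expr0 mulr1 -splitr.
    have := dotv_le_enorm (v' - v) (M v' - M v).
    rewrite dotvBr -(opprB v' v) dotvNl.
    have := ler_wpM2l (enorm_ge0 (v' - v)) (Mlip v'e ve).
    by rewrite expr2; nra.
  pose m := 2^-1 *: (v + v').
  have me : enorm m < eps.
    rewrite enormZ gtr0_norm ?invr_gt0//.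
    by have := enormD v v'; lra.
  have mv : m - v = 2^-1 *: (v' - v).
    by apply/rowP => i; rewrite !mxE; lra.
  have vm : v' - m = 2^-1 *: (v' - v).
    by apply/rowP => i; rewrite !mxE; lra.
  have := ih v m ve me; have := ih m v' me v'e.
  rewrite mv vm !dotvZl !enormZ gtr0_norm ?invr_gt0// !exprMn [2^-1 ^+ k.+1]exprS.
  have := dotv_le_enorm (v' - v) (M m - M v); rewrite dotvBr.
  have := ler_wpM2l (enorm_ge0 (v' - v)) (Mlip me ve).
  rewrite mv enormZ gtr0_norm ?invr_gt0//.
  move: (2^-1 ^+ k) => c; rewrite !expr2; lra.
apply/ler_addgt0Pr => e e0.
pose c := kappa / 2 * enorm (v' - v) ^+ 2.
have c0 : 0 <= c by rewrite mulr_ge0// ?sqr_ge0// divr_ge0// ltW.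
have [k ck] : exists k, c * 2^-1 ^+ k < e.
  exists (Num.bound (c / e)); set k := Num.bound _.
  rewrite exprVn ltr_pdivrMr ?exprn_gt0// mulrC -ltr_pdivrMr//.
  apply: lt_le_trans (archi_boundP _) _; first by rewrite divr_ge0// ltW.
  by rewrite -natrX ler_nat ltnW// ltn_expl.
apply: le_trans (key k _ _ ve v'e) _.
have -> : (kappa / 2 + kappa / 2 * 2^-1 ^+ k) * enorm (v' - v) ^+ 2
  = c + c * 2^-1 ^+ k by rewrite /c; ring.
by rewrite -/c; lra.
Qed.

(** Each tilt [v'] gives the lower bound [dotv v' x - psi v'] on [phi x]. Once [psi v'] is replaced
    by its descent bound this is a concave quadratic in [v'], maximal at
    [v + kappa^-1 *: (x - M v)], the tilt of the third hypothesis. *)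
Lemma tilt_growth v x : enorm v < eps -> enorm (x - xb) <= gamma ->
  enorm (v + kappa^-1 *: (x - M v)) < eps ->
  phi (M v) + dotv v (x - M v) + (2 * kappa)^-1 * enorm (x - M v) ^+ 2 <= phi x.
Proof.
move=> ve xg v'e.
have := le_trans (conj_ge v'e xg) (conj_descent ve v'e).
have -> : v + kappa^-1 *: (x - M v) - v = kappa^-1 *: (x - M v).
  by rewrite addrAC subrr add0r.
rewrite enormZ gtr0_norm ?invr_gt0// exprMn /psi.
rewrite dotvDl dotvZl dotvZl dotvBr sqr_enorm.
have -> : dotv (x - M v) (x - M v) = dotv (x - M v) x - dotv (x - M v) (M v).
  by rewrite dotvBr.
have k0 : kappa != 0 by rewrite gt_eqF.
have -> : kappa / 2 * (kappa^-1 ^+ 2 * (dotv (x - M v) x - dotv (x - M v) (M v)))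
  = (2 * kappa)^-1 * (dotv (x - M v) x - dotv (x - M v) (M v)) by field.
have -> : kappa^-1 = 2 * (2 * kappa)^-1 by field.
by move: ((2 * kappa)^-1) => c; lra.
Qed.

(** Adding the growth inequality to its copy with the tilts exchanged cancels the values of [phi]
    and doubles the coefficient. The auxiliary tilt of [tilt_growth] has norm at most
    [enorm u + enorm (u' - u)], whence [eps / 3]. *)
Lemma tilt_mono v v' : enorm v < eps / 3 -> enorm v' < eps / 3 ->
  enorm (M v - M v') ^+ 2 <= kappa * dotv (v - v') (M v - M v').
Proof.
have half u u' : enorm u < eps / 3 -> enorm u' < eps / 3 ->
    phi (M u) + dotv u (M u' - M u) + (2 * kappa)^-1 * enorm (M u' - M u) ^+ 2
      <= phi (M u').
  move=> ue u'e.
  have ue' : enorm u < eps by move: (enorm_ge0 u) eps0 => ? ?; lra.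
  have u'e' : enorm u' < eps by move: (enorm_ge0 u') eps0 => ? ?; lra.
  apply: tilt_growth => //; first by have [] := Margmin u'e'.
  apply: le_lt_trans (enormD _ _) _.
  have : enorm (kappa^-1 *: (M u' - M u)) <= enorm (u' - u).
    by rewrite enormZ gtr0_norm ?invr_gt0// mulrC ler_pdivrMr// mulrC Mlip.
  have := enormB u' u; lra.
move=> ve v'e; have := half v v' ve v'e; have := half v' v v'e ve.
rewrite (enormBC (M v')) -(opprB (M v) (M v')) dotvNr dotvBl => h1 h2.
have : (2 * kappa)^-1 * enorm (M v - M v') ^+ 2 *+ 2
   <= dotv v (M v - M v') - dotv v' (M v - M v') by lra.
have -> : (2 * kappa)^-1 * enorm (M v - M v') ^+ 2 *+ 2
   = enorm (M v - M v') ^+ 2 / kappa.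
  by field; rewrite gt_eqF.
by rewrite ler_pdivrMr// mulrC.
Qed.

Variables (r L : R).
Hypothesis r0 : 0 < r.
Hypothesis L0 : 0 < L.
Hypothesis M0 : M 0 = xb.
Hypothesis phi_grad : forall x, enorm (x - xb) < r -> has_gradient phi x (gphi x).
Hypothesis g_lip : forall x y, enorm (x - xb) < r -> enorm (y - xb) < r ->
  enorm (gphi x - gphi y) <= L * enorm (x - y).
Hypothesis eps_small : kappa * eps < Num.min gamma r.

Lemma argmin_near v : enorm v < eps -> enorm (M v - xb) < Num.min gamma r.
Proof.
move=> ve; rewrite -M0; apply: le_lt_trans eps_small.
apply: le_trans (Mlip ve _) _; first by rewrite enorm0.
by rewrite subr0 ler_pM2l// ltW.
Qed.

(** By [argmin_near] the minimizer is interior to the [gamma]-ball and lies where [phi] is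
    differentiable, so Fermat's rule applies. *)
Lemma gradient_argmin v : enorm v < eps -> gphi (M v) = v.
Proof.
move=> ve; have := argmin_near ve; rewrite lt_min => /andP[hg hr].
have [_ hmin] := Margmin ve.
apply: (@has_gradient_min _ _ phi (M v) _ _ (gamma - enorm (M v - xb))).
- by rewrite subr_gt0.
- exact: phi_grad.
- move=> y hy; apply: hmin; have := enorm_dist (M v) y xb; lra.
Qed.

(* A point near [xb] is [M u], where [u] minimizes [psi u - dotv u x] over a small ball:
   the minimizer is interior, so the gradient [M u - x] vanishes there. *)
Lemma argmin_onto : exists rho : R, 0 < rho /\ forall x, enorm (x - xb) < rho ->
  exists v, enorm v < eps / 3 /\ M v = x.
Proof.
have [a [a0 ae ae']] : exists a, [/\ 0 < a, a < eps / 3 & a < eps].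
  by exists (eps / 6); have := eps0; split; lra.
(* [c] is a strong monotonicity modulus of [M] at 0: combine [tilt_mono] with
   [enorm h <= L * enorm (M h - xb)], which holds since [gphi] inverts [M]. *)
pose c := (kappa * L ^+ 2)^-1.
have c0 : 0 < c by rewrite invr_gt0 mulr_gt0 ?exprn_gt0.
exists (c * a / 4); split=> [|x hx]; first by rewrite divr_gt0 ?mulr_gt0.
pose F v := psi v - dotv v x.
pose C := enorm xb + gamma + enorm x + 1.
have C0 : 0 < C by rewrite /C; move: (enorm_ge0 xb) (enorm_ge0 x) gamma0 => ???; lra.
have FC u v : enorm u <= a -> enorm v <= a -> F u - F v <= C * enorm (u - v).
  move=> ua va; have ue := le_lt_trans ua ae'; have ve := le_lt_trans va ae'.
  have := conj_subgrad ve ue; rewrite -(opprB u v) dotvNl.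
  have := dotv_le_enorm (u - v) (M u).
  have : enorm (M u) <= enorm xb + gamma.
    have [h _] := Margmin ue; have := enormD (M u - xb) xb; rewrite subrK; lra.
  have := norm_dotv_le (u - v) x; rewrite ler_norml => /andP[+ _].
  rewrite /F dotvBl; have := enorm_ge0 (u - v); rewrite /C; nra.
have [u [ua umin]] : exists u, enorm u <= a /\ forall v, enorm v <= a -> F u <= F v.
  apply: (lipschitz_EVT_min (ltW a0) C0) => u v ua va.
  by rewrite ler_norml FC// andbT lerNl opprB enormBC FC.
have ue := le_lt_trans ua ae'.
have ltu : enorm u < a.
  rewrite lt_def ua andbT; apply/negP => /eqP au.
  have := umin 0; rewrite enorm0 => /(_ (ltW a0)).
  (* The subgradient inequalities from 0 to [h] and from [h] to [u] bring in [M h], and show that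
     [psi u - psi 0 - dotv u xb] is at least [c * (a / 2) ^+ 2]. This exceeds [a * enorm (x - xb)]
     by the choice of the radius [c * a / 4]. *)
  pose h := 2^-1 *: u.
  have nh : enorm h = a / 2 by rewrite enormZ gtr0_norm ?invr_gt0// -au mulrC.
  have he3 : enorm h < eps / 3 by rewrite nh; lra.
  have he : enorm h < eps by rewrite nh; lra.
  have z3 : enorm (0 : 'rV[R]_n) < eps / 3 by rewrite enorm0 divr_gt0.
  have z1 : enorm (0 : 'rV[R]_n) < eps by rewrite enorm0.
  have := conj_subgrad ue he; have := conj_subgrad he z1.
  have -> : u - h = h by apply/rowP => i; rewrite !mxE; lra.
  rewrite subr0 M0 /F dot0v subr0.
  have := tilt_mono he3 z3; rewrite subr0 M0.
  have : enorm h <= L * enorm (M h - xb).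
    have := g_lip (x := M h) (y := M 0).
    rewrite !gradient_argmin ?M0 ?subrr ?subr0 ?enorm0//; apply => //.
    by have := argmin_near he; rewrite lt_min => /andP[].
  rewrite nh => h1 h2.
  have {h1 h2} : c * (a / 2) ^+ 2 <= dotv h (M h - xb).
    rewrite /c mulrC ler_pdivrMr ?mulr_gt0 ?exprn_gt0//.
    have := ler_wpM2l (ltW (exprn_gt0 2 L0)) h2.
    have : (a / 2) ^+ 2 <= (L * enorm (M h - xb)) ^+ 2.
      by rewrite ler_pXn2r ?nnegrE// ?mulr_ge0 ?divr_ge0 ?enorm_ge0// ltW.
    rewrite exprMn; nra.
  rewrite dotvBr => h1 h2 h3 h4.
  have : dotv u (x - xb) <= a * enorm (x - xb).
    by rewrite au dotv_le_enorm.
  have -> : dotv u (x - xb) = dotv u x - 2 * dotv h xb.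
    by rewrite dotvBr /h dotvZl mulrA divff// mul1r.
  have : a * enorm (x - xb) < a * (c * a / 4) by rewrite ltr_pM2l.
  rewrite expr2 in h1; lra.
exists u; split; first exact: lt_trans ltu ae.
apply/eqP; rewrite -subr_eq0 -enorm_eq0; apply/negPn/negP => e0.
have {}e0 : 0 < enorm (M u - x) by rewrite lt_def e0 enorm_ge0.
have [e he e0'] : exists2 e, dotv e (M u) - dotv e x = enorm e ^+ 2 & 0 < enorm e.
  by exists (M u - x); rewrite // -dotvBr sqr_enorm.
move: e0' => {}e0.
(* The first bound keeps [u - s *: e] in the ball; the second makes the quadratic term of
   [conj_descent] at most half of the linear decrease. *)
pose s := Num.min ((a - enorm u) / enorm e) kappa^-1.
have s0 : 0 < s by rewrite lt_min invr_gt0 kappa0 andbT divr_gt0// subr_gt0.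
have sk : s * kappa <= 1.
  by rewrite -ler_pdivlMr// mul1r ge_min lexx orbT.
have sa : s * enorm e <= a - enorm u.
  by rewrite -ler_pdivlMr// ge_min lexx.
have va : enorm (u - s *: e) <= a.
  by have := enormB u (s *: e); rewrite enormZ gtr0_norm//; lra.
have := umin _ va; have := conj_descent ue (le_lt_trans va ae').
have -> : u - s *: e - u = - (s *: e) by rewrite addrAC subrr sub0r.
rewrite /F enormN enormZ gtr0_norm// !dotvE.
move=> h2 h3.
have : s * (dotv e (M u) - dotv e x) = s * enorm e ^+ 2 by rewrite he.
move=> h1; have : s * enorm e ^+ 2 <= kappa / 2 * (s * enorm e) ^+ 2 by lra.
have := mulr_gt0 s0 (mulr_gt0 e0 e0).
rewrite exprMn !expr2; nra.
Qed.
End Tilt.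

(** Near [xb] every point is some [M v], and [gphi] recovers [v] from it, so [tilt_mono] turns into
    a statement about [gphi]. *)
Lemma tilt_strongly_monotone (R : realType) (n : nat) (phi : 'rV[R]_n -> R)
    (gphi : 'rV[R]_n -> 'rV[R]_n) (xb : 'rV[R]_n) (kappa : R) :
  0 < kappa -> C11_near phi gphi xb -> tilt_stable phi xb kappa ->
  gphi xb = 0 /\
  exists rho : R, 0 < rho /\ exists L : R, 0 < L /\
   forall x y, enorm (x - xb) < rho -> enorm (y - xb) < rho ->
     enorm (gphi x - gphi y) <= L * enorm (x - y) /\
     enorm (x - y) ^+ 2 <= kappa * dotv (gphi x - gphi y) (x - y).
Proof.
move=> k0 [r [r0 [hgrad [L' hL']]]] [gamma [gamma0 [eps' [eps'0 [M [hM [Ml M0]]]]]]].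
pose L := `|L'| + 1.
have L0 : 0 < L by rewrite /L; move: (normr_ge0 L') => ?; lra.
have hL x y : enorm (x - xb) < r -> enorm (y - xb) < r ->
  enorm (gphi x - gphi y) <= L * enorm (x - y).
  move=> xr yr; apply: le_trans (hL' _ _ xr yr) _.
  rewrite ler_wpM2r ?enorm_ge0// /L; move: (ler_norm L'); lra.
pose m := Num.min gamma r.
have m0 : 0 < m by rewrite lt_min gamma0.
pose eps := Num.min eps' (m / (2 * kappa)).
have eps0 : 0 < eps by rewrite lt_min eps'0 divr_gt0// mulr_gt0.
have ee v : enorm v < eps -> enorm v < eps' by rewrite lt_min => /andP[].
have epsm : kappa * eps < m.
  have : eps <= m / (2 * kappa) by rewrite ge_min lexx orbT.
  rewrite ler_pdivlMr ?mulr_gt0//; lra.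
have Marg v : enorm v < eps -> is_tilt_argmin phi xb gamma v (M v).
  by move=> /ee ve; apply/(hM v ve).
have Mlip v v' : enorm v < eps -> enorm v' < eps ->
  enorm (M v - M v') <= kappa * enorm (v - v').
  by move=> /ee ve /ee v'e; exact: Ml.
have gM v : enorm v < eps -> gphi (M v) = v.
  exact: (gradient_argmin k0 eps0 Marg Mlip M0 hgrad epsm).
have [rho [rho0 onto]] := argmin_onto k0 eps0 gamma0 Marg Mlip r0 L0 M0 hgrad hL epsm.
split; first by rewrite -M0 gM// enorm0.
exists (Num.min rho r); split; first by rewrite lt_min rho0.
exists L; split=> // x y; rewrite !lt_min => /andP[xr xr'] /andP[yr yr'].
split; first exact: hL.
have [v [ve <-]] := onto x xr; have [w [we <-]] := onto y yr.
have e3 u : enorm u < eps / 3 -> enorm u < eps by move: (enorm_ge0 u) => ??; lra.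
by rewrite !gM ?e3//; exact: (tilt_mono k0 eps0 Marg Mlip ve we).
Qed.

(** * Lipschitz functions of one variable *)

Section Lipschitz1D.
Variable R : realType.
Implicit Types (h : R -> R) (t a L : R).

Definition deriv1_at h t a := forall e : R, 0 < e -> exists d : R, 0 < d /\
  forall s, `|s| < d -> `|h (t + s) - h t - a * s| <= e * `|s|.

Lemma derivable_deriv1_at h t : derivable h t 1 -> deriv1_at h t (derive1 h t).
Proof.
move=> /cvg_ex[/= l hl]; have -> : derive1 h t = l by rewrite derive1E; apply: cvg_lim hl.
move=> e e0; have /cvgrPdist_lt/(_ e e0) := hl.
rewrite near_withinE => /nbhs_ballP[d/= d0 hd].
exists d; split=> // s sd; have [->|s0] := eqVneq s 0.
  by rewrite addr0 subrr mulr0 subrr normr0 mulr0.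
have := hd s; rewrite -ball_normE/= sub0r normrN => /(_ sd s0).
rewrite [_ *: _ + _]addrC /GRing.scale/= mulr1 => /ltW h1.
have -> : h (t + s) - h t - l * s = - (l - s^-1 * (h (t + s) - h t)) * s.
  by field.
by rewrite normrM normrN ler_wpM2r.
Qed.

Lemma deriv1_at_unique h t a b : deriv1_at h t a -> deriv1_at h t b -> a = b.
Proof.
move=> ha hb; apply/eqP; rewrite -subr_eq0 -normr_le0; apply/ler_addgt0Pr => e e0.
have e2 : 0 < e / 2 by rewrite divr_gt0.
have [d [d0 hd]] := ha _ e2; have [d' [d'0 hd']] := hb _ e2.
pose s := Num.min d d' / 2.
have m0 : 0 < Num.min d d' by rewrite lt_min d0.
have s0 : 0 < s by rewrite divr_gt0.
have ns : `|s| = s by rewrite gtr0_norm.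
have sm : s < Num.min d d' by rewrite /s; lra.
have [sd sd'] : s < d /\ s < d' by move: sm; rewrite lt_min => /andP.
have := hd s; have := hd' s; rewrite ns => /(_ sd') h1 /(_ sd) h2.
rewrite add0r -(ler_pM2r s0) -{1}ns -normrM.
move: h1 h2; rewrite !ler_norml => /andP[? ?] /andP[? ?].
by rewrite mulrBl; apply/andP; split; lra.
Qed.

(** * Almost everywhere differentiability through Stieltjes measures *)

Section LS.
Variables (h : R -> R) (L : R).
Hypothesis L0 : 0 < L.
Hypothesis hL : forall x y, `|h x - h y| <= L * `|x - y|.

(* Both functions are nondecreasing and their sum is [2 L t]: hence the Stieltjes measure of
   [ls_up] is dominated by the Lebesgue measure. *)
Definition ls_up t := h t + L * t.
Definition ls_dn t := L * t - h t.

Let lip_cont : continuous h.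
Proof.
move=> x; apply/cvgrPdist_lt => e e0; near=> y.
apply: le_lt_trans (hL _ _) _; rewrite mulrC -ltr_pdivlMr//.
by near: y; apply/nbhs_ballP; exists (e / L) => [|y]; rewrite -?ball_normE//= divr_gt0.
Unshelve. all: end_near. Qed.

Let hb x y : x <= y -> h y - h x <= L * (y - x) /\ h x - h y <= L * (y - x).
Proof.
move=> xy; have := hL y x; rewrite (ger0_norm (_ : 0 <= y - x)) ?subr_ge0//.
by rewrite ler_norml => /andP[? ?]; split; lra.
Qed.

Let up_nd : {homo ls_up : x y / x <= y}.
Proof. by move=> x y /hb[? ?]; rewrite /ls_up; lra. Qed.

Let dn_nd : {homo ls_dn : x y / x <= y}.
Proof. by move=> x y /hb[? ?]; rewrite /ls_dn; lra. Qed.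

Let up_rc : right_continuous ls_up.
Proof.
apply/right_continuousW => x; apply: cvgD; first exact: lip_cont.
by apply: cvgMr; exact: cvg_id.
Qed.

Let dn_rc : right_continuous ls_dn.
Proof.
apply/right_continuousW => x; apply: cvgB; last exact: lip_cont.
by apply: cvgMr; exact: cvg_id.
Qed.

HB.instance Definition _ := isCumulative.Build R _ R ls_up up_nd up_rc.
HB.instance Definition _ := isCumulative.Build R _ R ls_dn dn_nd dn_rc.

Let mu : {measure set (measurableTypeR R) -> \bar R} := lebesgue_measure.
Let nu : {measure set (measurableTypeR R) -> \bar R} := lebesgue_stieltjes_measure ls_up.
Let nu' : {measure set (measurableTypeR R) -> \bar R} := lebesgue_stieltjes_measure ls_dn.

Let ls_ocitv (f : cumulative R R) (a b : R) : a <= b ->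
  lebesgue_stieltjes_measure f `]a, b] = (f b - f a)%:E.
Proof.
move=> ab; rewrite /lebesgue_stieltjes_measure /measure_extension/=.
by rewrite measurable_mu_extE/=; [rewrite wlength_itv_bnd|exact: is_ocitv].
Qed.

Let nu_sum A : measurable A -> mu A = ((2 * L)^-1%:E * (nu A + nu' A))%E.
Proof.
have c0 : 0 <= (2 * L)^-1 by rewrite invr_ge0 mulr_ge0// ltW.
move=> mA.
transitivity (mscale (NngNum c0) (measure_add nu nu') A); last first.
  by rewrite /mscale; congr mule; exact: measure_addE.
apply: lebesgue_measure_unique mA => X [[a b] _ <-] /=.
have [ab|ba] := leP a b; last first.
  by rewrite set_itv_ge ?measure0// bnd_simp -leNgt ltW.
transitivity (b - a)%:E; first exact: ls_ocitv.
rewrite /mscale [X in (_ * X)%E](measure_addE nu nu').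
rewrite (_ : nu _ = (ls_up b - ls_up a)%:E); last exact: ls_ocitv.
rewrite (_ : nu' _ = (ls_dn b - ls_dn a)%:E); last exact: ls_ocitv.
rewrite -EFinD -EFinM /ls_up /ls_dn; congr EFin => /=.
by field; rewrite gt_eqF.
Qed.

Let nu_dom A : measurable A -> mu A = 0%E -> nu A = 0%E.
Proof.
move=> mA; rewrite nu_sum// => /eqP; rewrite mule_eq0 => /orP[|].
  by rewrite eqe invr_eq0 mulf_eq0 pnatr_eq0/= gt_eqF.
by rewrite padde_eq0 ?measure_ge0// => /andP[/eqP].
Qed.

(** [f] is the Radon-Nikodym density of the Stieltjes measure of [ls_up]. Lebesgue differentiation
    makes it the derivative of [h t + L * t] almost everywhere, hence the shift by [L]. *)
Lemma lipschitz_density : exists f : R -> R,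
  [/\ measurable_fun setT f, forall t, 0 <= f t,
   (\int[lebesgue_measure]_(t in [set` `]0%R, 1%R]]) (f t)%:E)%E = (h 1 - h 0 + L)%:E &
   {ae lebesgue_measure, forall t, 0 < t -> t < 1 -> deriv1_at h t (f t - L)}].
Proof.
have mD : measurable (`]0, 1]%classic : set (measurableTypeR R)) by exact: measurable_itv.
have nuD : (nu `]0%R, 1%R]%classic < +oo)%E.
  by rewrite (_ : nu _ = (ls_up 1 - ls_up 0)%:E) ?ltry//; exact: ls_ocitv.
(* Restriction to []0, 1]] makes the measure finite, as Radon-Nikodym demands; derivatives are only
   claimed inside this interval. *)
pose nuf : {finite_measure set (measurableTypeR R) -> \bar R} := mfrestr mD nuD.
have dom : nuf `<< mu.
  apply/null_content_dominatesP => A mA A0; rewrite /nuf/= /mfrestr /mrestr.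
  apply/eqP; rewrite -measure_le0 -(nu_dom mA A0).
  by apply: le_measure; rewrite ?inE//; exact: measurableI.
have [g [g0 gfin gint gE]] := radon_nikodym_sigma_finite dom.
pose f t := fine (g t).
have fg : EFin \o f = g by apply/funext => t; rewrite /= fineK.
have intf : mu.-integrable setT (EFin \o f) by rewrite fg.
have nuE x : 0 <= x -> x <= 1 ->
    (\int[mu]_(t in [set` `]0%R, x]]) (f t)%:E)%E = (ls_up x - ls_up 0)%:E.
  move=> x0 x1; have mx : measurable (`]0, x]%classic : set (measurableTypeR R)) by exact: measurable_itv.
  rewrite -[LHS](_ : nuf `]0, x]%classic = _); last first.
    by rewrite gE//; apply: eq_integral => t _; rewrite /f fineK.
  rewrite /nuf/= /mfrestr /mrestr setIidl; first exact: ls_ocitv.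
  by apply: subset_itvl; rewrite bnd_simp.
exists f; split.
- by apply/measurable_EFinP; rewrite fg; exact: measurable_int gint.
- by move=> t; exact: fine_ge0.
- by rewrite nuE// /ls_up; congr EFin; lra.
have H1 y : lebesgue_measure.-integrable [set` Interval (BRight 0) (BRight y)] (EFin \o f).
  by apply: integrableS intf.
have H2 : locally_integrable [set: R] f.
  by apply: open_integrable_locally => //; exact: openT.
have := FTC1 H1 H2.
apply: filterS; first exact: (ae_filter_ringOfSetsType lebesgue_measure).
move=> t ht t0 t1.
have [|hd he] := ht; first by rewrite lte_fin.
have := derivable_deriv1_at hd; rewrite he => hF e e0.
have [d [d0 {}hF]] := hF e e0.
exists (Num.min d (Num.min t (1 - t))); split.
  by rewrite !lt_min d0 t0 subr_gt0.
move=> s; rewrite !lt_min ltr_norml => /and3P[sd st st1].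
rewrite !ltr_norml in st st1.
have {st} st : 0 <= t + s by lra.
have {st1} st1 : t + s <= 1 by lra.
have sd' : `|s| < d by rewrite ltr_norml.
have := hF s sd'; rewrite /Rintegral !nuE ?(ltW t0) ?(ltW t1)//= /ls_up.
congr (_ <= _); congr (`|_|); ring.
Qed.

End LS.

(** Uniqueness of derivatives identifies [a] with [f t - L] at almost every [t]; integrating the
    density then gives the increment of [h]. *)
Lemma lipschitz_mean_value h L c (Z : set (measurableTypeR R)) : 0 < L ->
  (forall x y, `|h x - h y| <= L * `|x - y|) ->
  lebesgue_measure.-negligible Z ->
  (forall t, 0 < t -> t < 1 -> ~ Z t -> exists a, c <= a /\ deriv1_at h t a) ->
  c <= h 1 - h 0.
Proof.
move=> L0 hL Z0 hc; have [f [mf f0 intf aef]] := lipschitz_density L0 hL.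
(* Truncation at 0 fits the comparison of nonnegative integrands, and [f], being nonnegative, still
   dominates it. *)
pose m := Num.max 0 (c + L).
have m0 : 0 <= m by rewrite le_max lexx.
suff : (m%:E <= (h 1 - h 0 + L)%:E)%E.
  by rewrite lee_fin ge_max => /andP[_ ?]; lra.
rewrite -intf.
have -> : m%:E = (\int[lebesgue_measure]_(t in [set` `]0%R, 1%R]]) (cst m%:E t))%E.
  rewrite integral_cst//=; by rewrite lebesgue_measure_itv/= lte_fin ltr01 oppr0 adde0 mule1.
apply: ae_ge0_le_integral => //.
  by move=> t ?; rewrite lee_fin f0.
  by apply/measurable_EFinP; exact: measurable_funTS.
have Z1 : {ae lebesgue_measure, forall t : measurableTypeR R, ~ Z t}.
  by have [N [mN N0 ZN]] := Z0; exists N; split => // t /= /contrapT; exact: ZN.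
have Z2 : {ae lebesgue_measure, forall t : measurableTypeR R, t != 1}.
  exists [set (1 : R)]; split => [||t /= /negP]; [exact: measurable_set1|exact: lebesgue_measure_set1|].
  by rewrite negbK => /eqP.
apply: (@filterS3 _ _ (ae_filter_ringOfSetsType lebesgue_measure) _ _ _ _ _ Z1 Z2 aef).
move=> t Zt tn1 ht; rewrite /= in_itv/= => /andP[t0 t1]; rewrite lee_fin /m ge_max f0/=.
have {tn1 t1} t1 : t < 1 by rewrite lt_def eq_sym tn1.
have [a [ca ha]] := hc t t0 t1 Zt.
by have := ht t0 t1 => /(deriv1_at_unique ha) fa; lra.
Qed.

End Lipschitz1D.

(** * Null sets of the unit cube *)

Section NullSets.
Variables (R : realType) (n : nat).
Local Notation V := 'rV[R]_n.
Local Notation R' := (measurableTypeR R).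
Local Notation leb := (@lebesgue_measure R).
Implicit Types (s : V) (E F : set V) (i j : 'I_n) (l : seq 'I_n).

Definition upd s i (a : R) : V := \row_j (if j == i then a else s 0 j).

Lemma updC s i j a b : i != j -> upd (upd s i a) j b = upd (upd s j b) i a.
Proof.
move=> ij; apply/rowP => k; rewrite !mxE.
by have [->|//] := eqVneq k i; rewrite (negPf ij).
Qed.

(* Measurability is pulled back along row vectors from [n.-tuple R], which carries the
   product sigma-algebra in the library. *)
Let row_of (t : n.-tuple R') : V := \row_j tnth t j.

Definition borel E := measurable (row_of @^-1` E).

Lemma borelC E : borel E -> borel (~` E).
Proof. by rewrite /borel preimage_setC; exact: measurableC. Qed.

Lemma borel0 : borel set0.
Proof. by rewrite /borel preimage_set0. Qed.

Lemma borel_bigcup (K : countType) (E : K -> set V) :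
  (forall k, borel (E k)) -> borel (\bigcup_k E k).
Proof.
move=> bE; rewrite /borel preimage_bigcup.
by apply: countable_bigcupT_measurable.
Qed.

Lemma borel_bigcap (K : countType) (E : K -> set V) :
  (forall k, borel (E k)) -> borel (\bigcap_k E k).
Proof.
move=> bE; rewrite -[X in borel X]setCK setC_bigcap; apply: borelC.
by apply: borel_bigcup => k; exact: borelC.
Qed.

Lemma borel_coord i (A : set R') : measurable A -> borel [set s | A (s 0 i)].
Proof.
move=> mA; have := measurable_tnth i measurableT mA.
by rewrite setTI /borel; congr measurable; apply/seteqP; split=> t /=; rewrite mxE.
Qed.

Definition unit_section s i E : set R' := [set a | 0 < a < 1 /\ E (upd s i a)].

(* The points whose line in direction [i] meets [E], inside the open unit interval, in a set
   of positive length. Fubini makes these operators commute, so that emptiness of the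
   iterated shadow is a notion of null set that does not depend on the order of integration. *)
Definition shadow i E : set V := [set s | leb (unit_section s i E) != 0%E].

Lemma shadowP i E s : shadow i E s <-> leb (unit_section s i E) <> 0%E.
Proof. by rewrite /shadow /mkset; split=> /eqP. Qed.

Let upd_t i (z : n.-tuple R' * R') : n.-tuple R' :=
  [tuple (if j == i then z.2 else tnth z.1 j) | j < n].

Let row_upd_t i t a : row_of (upd_t i (t, a)) = upd (row_of t) i a.
Proof. by apply/rowP => k; rewrite !mxE tnth_mktuple /=; case: eqP; rewrite ?mxE. Qed.

Let measurable_upd_t i : measurable_fun setT (upd_t i).
Proof.
apply/measurable_fun_tnthP => j.
have -> : (tnth (T := R'))^~ j \o upd_t i =
    if j == i then snd else (tnth (T := R'))^~ j \o fst.
  by apply/funext => z /=; rewrite tnth_mktuple; case: eqP.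
case: eqP => _ //; apply: measurableT_comp => //; exact: measurable_tnth.
Qed.

Let unit_itv : set R' := [set a | 0 < a < 1].

Let measurable_unit_itv : measurable unit_itv.
Proof.
have -> : unit_itv = `]0%R, 1%R[%classic by apply/seteqP; split=> a /=; rewrite in_itv.
exact: measurable_itv.
Qed.

Lemma borel_unit_section s i E : borel E -> measurable (unit_section s i E).
Proof.
move=> bE; pose t : n.-tuple R' := [tuple s 0 j | j < n].
have st : row_of t = s by apply/rowP => j; rewrite mxE tnth_mktuple.
have := measurable_upd_t i measurableT bE; rewrite setTI => m1.
have := pair1_measurable t measurableT m1; rewrite setTI => m2.
have := measurableI _ _ measurable_unit_itv m2; congr measurable.
by apply/seteqP; split=> a /=; rewrite row_upd_t st.
Qed.

Lemma borel_shadow i E : borel E -> borel (shadow i E).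
Proof.
move=> bE; have := measurable_upd_t i measurableT bE; rewrite setTI => m1.
have m2 := measurableI _ _ m1 (measurableX (@measurableT _ (n.-tuple R')) measurable_unit_itv).
have := measurable_fun_xsection leb m2 measurableT (emeasurable_set1 0%E).
rewrite setTI => m3; have := measurableC m3; congr measurable.
set A := _ `&` _.
have key t : xsection A t = unit_section (row_of t) i E.
  apply/seteqP; split=> a; rewrite /xsection/= inE/= /A/= row_upd_t; first by case=> ? [].
  by case.
by apply/seteqP; split=> t /=; rewrite key => /eqP.
Qed.

Lemma shadow_subset i E F : borel E -> borel F -> E `<=` F -> shadow i E `<=` shadow i F.
Proof.
move=> bE bF EF s; rewrite /shadow/= -!measure_gt0 => /lt_le_trans; apply.
apply: le_measure; rewrite ?inE; try exact: borel_unit_section.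
by move=> a [? /EF].
Qed.

Lemma shadow_bigcup i (E : nat -> set V) : (forall k, borel (E k)) ->
  shadow i (\bigcup_k E k) `<=` \bigcup_k shadow i (E k).
Proof.
move=> bE s; apply: contraPP => /= h; apply/negP; rewrite negbK; apply/eqP.
have -> : unit_section s i (\bigcup_k E k) = \bigcup_k unit_section s i (E k).
  apply/seteqP; split=> [a [a01 [k _ Ek]]|a [k _ [a01 Ek]]]; first by exists k.
  by split=> //; exists k.
apply/negligibleP; last apply: negligible_bigcup => k.
  by apply: bigcup_measurable => k _; exact: borel_unit_section.
apply/negligibleP; first exact: borel_unit_section.
have [//|hk] := eqVneq (leb (unit_section s i (E k))) 0%E.
by case: h; exists k.
Qed.

(** Both sides say that [P] has area zero: Tonelli equates the two integrals of section lengths, and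
    a nonnegative integral vanishes exactly when its integrand does almost everywhere. *)
Let sections_null (P : set (R' * R')) : measurable P ->
  leb [set a | leb (xsection P a) != 0%E] = 0%E <->
  leb [set b | leb (ysection P b) != 0%E] = 0%E.
Proof.
move=> mP.
have aux (f : R' -> \bar R) : measurable_fun setT f -> (forall x, 0 <= f x)%E ->
    leb [set a | f a != 0%E] = 0%E <-> (\int[leb]_x f x)%E = 0%E.
  move=> mf f0; have mA : measurable [set a | f a != 0%E].
    have := measurableC (mf measurableT _ (emeasurable_set1 0%E)).
    by rewrite setTI; congr measurable; apply/seteqP; split=> a /= /eqP.
  rewrite -(negligibleP leb mA).
  have -> : (\int[leb]_x f x = \int[leb]_x `|f x|)%E.
    by apply: eq_integral => x _; rewrite gee0_abs.
  rewrite ae_eq_integral_abs//; split=> -[N [mN N0 h]]; exists N; split=> // a /= fa; apply: h => /=.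
    by apply/eqP => fa0; apply: fa.
  by move=> h; move: fa; rewrite h ?eqxx.
have mx : measurable_fun setT (fun a => leb (xsection P a)) := measurable_fun_xsection leb mP.
have my : measurable_fun setT (fun a => leb (ysection P a)) := measurable_fun_ysection leb mP.
rewrite (aux _ mx)// (aux _ my)//.
have := indic_fubini_tonelli leb leb mP.
by rewrite indic_fubini_tonelli_FE// indic_fubini_tonelli_GE// => ->.
Qed.

(** In the plane through [s] spanned by directions [i] and [j], both sides ask whether the trace [P]
    of [E] on the unit square has positive area. *)
Lemma shadow_commute i j E : borel E -> shadow i (shadow j E) = shadow j (shadow i E).
Proof.
have [->//|ij] := eqVneq i j => bE.
suff main s : leb (unit_section s i (shadow j E)) = 0%E <->
    leb (unit_section s j (shadow i E)) = 0%E.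
  apply/seteqP; split=> s /shadowP h; apply/shadowP => h'; apply: h.
    exact: (main s).2.
  exact: (main s).1.
pose t : n.-tuple R' := [tuple s 0 k | k < n].
have st : row_of t = s by apply/rowP => k; rewrite mxE tnth_mktuple.
pose g (z : R' * R') := upd_t j (upd_t i (t, z.1), z.2).
have mg : measurable_fun setT g.
  apply: measurableT_comp; first exact: measurable_upd_t.
  apply: measurable_fun_pair => //; apply: measurableT_comp; first exact: measurable_upd_t.
  by apply: measurable_fun_pair => //; exact: measurable_cst.
have gE z : row_of (g z) = upd (upd s i z.1) j z.2 by rewrite !row_upd_t st.
have := mg measurableT _ bE; rewrite setTI => m1.
pose P := (unit_itv `*` unit_itv) `&` (g @^-1` (row_of @^-1` E)).
have mP : measurable P by apply: measurableI => //; exact: measurableX.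
have := sections_null mP.
have secx a : 0 < a < 1 -> xsection P a = unit_section (upd s i a) j E.
  move=> a01; apply/seteqP; split=> b; rewrite /xsection/= inE/= /P/= gE; first by case=> -[].
  by case.
have secy a : 0 < a < 1 -> ysection P a = unit_section (upd s j a) i E.
  move=> a01; apply/seteqP; split=> b; rewrite /ysection/= inE/= /P/= gE updC//; first by case=> -[].
  by case.
have -> : [set a | leb (xsection P a) != 0%E] = unit_section s i (shadow j E).
  apply/seteqP; split=> [a h|a [a01 h]]; last by rewrite /mkset (secx _ a01).
  have a01 : 0 < a < 1.
    apply: contraNT h => a01; rewrite (_ : xsection P a = set0) ?measure0//.
    by apply/seteqP; split=> b //; rewrite /xsection/= inE => -[[/= h _] _]; rewrite h in a01.
  by split=> //; move: h; rewrite /mkset (secx _ a01).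
have -> // : [set b | leb (ysection P b) != 0%E] = unit_section s j (shadow i E).
apply/seteqP; split=> [a h|a [a01 h]]; last by rewrite /mkset (secy _ a01).
have a01 : 0 < a < 1.
  apply: contraNT h => a01; rewrite (_ : ysection P a = set0) ?measure0//.
  by apply/seteqP; split=> b //; rewrite /ysection/= inE => -[[/= _ h] _]; rewrite h in a01.
by split=> //; move: h; rewrite /mkset (secy _ a01).
Qed.

Definition shadows l E := foldr shadow E l.

Lemma borel_shadows l E : borel E -> borel (shadows l E).
Proof. by move=> bE; elim: l => //= i l; exact: borel_shadow. Qed.

Lemma shadows_bigcup l (E : nat -> set V) : (forall k, borel (E k)) ->
  shadows l (\bigcup_k E k) `<=` \bigcup_k shadows l (E k).
Proof.
move=> bE; elim: l => //= i l ih.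
have b1 k : borel (shadows l (E k)) by exact: borel_shadows.
apply: subset_trans (shadow_bigcup b1).
apply: shadow_subset ih; last exact: borel_bigcup.
by apply: borel_shadows; exact: borel_bigcup.
Qed.

Lemma shadows_perm l l' E : borel E -> perm_eq l l' -> shadows l E = shadows l' E.
Proof.
move=> bE; elim: l l' => [|i l ih] l'.
  by move=> /perm_size /esym/size0nil ->.
move=> hp; have il' : i \in l' by rewrite -(perm_mem hp) mem_head.
rewrite /= (ih (rem i l')); last first.
  by rewrite -(perm_cons i) (perm_trans hp)// perm_to_rem.
elim: l' il' {hp ih} => //= j l' ih; rewrite inE.
have [->//|ji] := eqVneq j i.
move=> /= il'.
by rewrite shadow_commute ?ih//; exact: borel_shadows.
Qed.

Definition null E := borel E /\ shadows (enum 'I_n) E = set0.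

(** The order of the shadows is free, so direction [i] may act first; its shadow is already empty,
    and the empty set only casts empty shadows. *)
Lemma null_line E i : borel E -> (forall s, leb (unit_section s i E) = 0%E) -> null E.
Proof.
move=> bE h; split=> //.
have -> : shadows (enum 'I_n) E = shadows (rcons (rem i (enum 'I_n)) i) E.
  apply: shadows_perm => //; rewrite perm_sym perm_rcons perm_sym perm_to_rem//.
  by rewrite mem_enum.
rewrite /shadows -cats1 foldr_cat /=.
have -> : shadow i E = set0.
  by apply/seteqP; split=> s //; rewrite /shadow/= h eqxx.
elim: (rem _ _) => //= j l ->; apply/seteqP; split=> s //; rewrite /shadow/=.
rewrite (_ : unit_section s j set0 = set0) ?measure0 ?eqxx//.
by apply/seteqP; split=> a // [].
Qed.

Lemma null_bigcup (E : nat -> set V) : (forall k, null (E k)) -> null (\bigcup_k E k).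
Proof.
move=> nE; split; first by apply: borel_bigcup => k; have [] := nE k.
apply/seteqP; split=> // s /shadows_bigcup[|k _]; first by move=> k; have [] := nE k.
by have [_ ->] := nE k.
Qed.

(** A shadow along [i] ignores coordinate [i], so only the coordinates outside [l] need to be
    constrained. *)
Lemma shadows_cube l F : [set s : V | forall j, 0 < s 0 j < 1] `<=` F ->
  forall s, (forall j, j \notin l -> 0 < s 0 j < 1) -> shadows l F s.
Proof.
move=> CF; elim: l => [|i l ih] s hs /=; first by apply: CF => j; exact: hs.
rewrite /shadow/= (_ : unit_section s i (shadows l F) = unit_itv).
  have -> : unit_itv = `]0%R, 1%R[%classic by apply/seteqP; split=> a /=; rewrite in_itv.
  by rewrite lebesgue_measure_itv/= lte_fin ltr01 oppr0 adde0 eqe oner_eq0.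
apply/seteqP; split=> a; first by case.
move=> a01; split=> //; apply: ih => j jl; rewrite mxE.
have [//|ji] := eqVneq j i; apply: hs.
by rewrite inE negb_or ji.
Qed.

(** Otherwise the shadow along [i], made to act first, contains the open cube, and so do all later
    shadows by [shadows_cube]; the centre of the cube contradicts emptiness. *)
Lemma null_line_witness E i : null E ->
  exists s, (forall j, 0 < s 0 j < 1) /\ leb (unit_section s i E) = 0%E.
Proof.
move=> [bE nE]; apply: contrapT => h.
have hp : perm_eq (enum 'I_n) (rcons (rem i (enum 'I_n)) i).
  by rewrite perm_sym perm_rcons perm_sym perm_to_rem// mem_enum.
rewrite (shadows_perm bE hp) /shadows -cats1 foldr_cat /= in nE.
have := @shadows_cube (rem i (enum 'I_n)) (shadow i E) _ (const_mx 2^-1) _.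
rewrite {1}/shadows nE; apply.
  move=> s hs; rewrite /shadow/=; apply/eqP => h0; apply: h.
  by exists s.
move=> j _; rewrite mxE; lra.
Qed.

Lemma null0 : null set0.
Proof.
split; first exact: borel0.
elim: (enum _) => //= j l ->; apply/seteqP; split=> s //; rewrite /shadow/=.
rewrite (_ : unit_section s j set0 = set0) ?measure0 ?eqxx//.
by apply/seteqP; split=> a // [].
Qed.

(* Vacuous outside the open unit cube, whose complement is null. *)
Definition ae_cube (P : V -> Prop) := exists E, null E /\ forall s, ~ E s -> P s.

Lemma ae_cube_all (K : countType) (P : K -> V -> Prop) :
  (forall k, ae_cube (P k)) -> ae_cube (fun s => forall k, P k s).
Proof.
move=> /choice[E hE].
pose F m := if unpickle m is Some k then E k else set0.
exists (\bigcup_m F m); split.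
  by apply: null_bigcup => m; rewrite /F; case: unpickle => [k|]; [have [] := hE k|exact: null0].
move=> s hs k; have [_ h] := hE k; apply: h => Es; apply: hs.
by exists (pickle k) => //; rewrite /F pickleK.
Qed.

Lemma ae_cube_imp (P Q : V -> Prop) : (forall s, P s -> Q s) -> ae_cube P -> ae_cube Q.
Proof. by move=> PQ [E [nE h]]; exists E; split=> // s /h /PQ. Qed.

Lemma ae_cube_and (P Q : V -> Prop) : ae_cube P -> ae_cube Q -> ae_cube (fun s => P s /\ Q s).
Proof.
move=> hP hQ; pose F (b : bool) := if b then P else Q.
have := @ae_cube_all bool F _; case=> [[]//|E [nE h]].
by exists E; split=> // s /h hs; split; [exact: (hs true)|exact: (hs false)].
Qed.

Lemma borel_open U : (forall s, U s -> exists e, 0 < e /\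
    forall s', (forall j, `|s' 0 j - s 0 j| < e) -> U s') -> borel U.
Proof.
move=> oU.
pose box (z : 'rV[rat]_n * nat) := [set s : V | forall j, `|s 0 j - ratr (z.1 0 j)| < z.2.+1%:R^-1].
pose D (z : 'rV[rat]_n * nat) := if `[< box z `<=` U >] then box z else set0.
have -> : U = \bigcup_z D z.
  apply/seteqP; split=> s; last first.
    by case=> z _; rewrite /D; case: asboolP => // + bz; exact.
  move=> Us; have [e [e0 he]] := oU s Us.
  have [k ke] : exists k, k.+1%:R^-1 + k.+1%:R^-1 <= e.
    have e2 : 0 < e / 2 by rewrite divr_gt0.
    have [k hk] := ltr_add_invr e2.
    by exists k; rewrite add0r in hk; rewrite [leRHS]splitr lerD// ltW.
  have k0 : 0 < k.+1%:R^-1 :> R by rewrite invr_gt0.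
  have /choice[q hq] : forall j, exists q : rat, `|s 0 j - ratr q| < k.+1%:R^-1.
    move=> j; have lt1 : s 0 j - k.+1%:R^-1 < s 0 j + k.+1%:R^-1.
      by rewrite ltrBlDr -addrA ltrDl addr_gt0.
    have [q] := rat_in_itvoo lt1.
    by rewrite in_itv/= => /andP[? ?]; exists q; rewrite distrC ltr_distl; apply/andP.
  exists (\row_j q j, k) => //; rewrite /D; case: asboolP => [_|]; first by move=> j /=; rewrite mxE.
  case=> s' /= hs'; apply: he => j.
  have := hs' j; rewrite mxE => h1; have := hq j => h2; rewrite distrC in h2.
  by apply: lt_le_trans ke; apply: le_lt_trans (ler_distD (ratr (q j)) _ _) _; rewrite ltrD.
apply: borel_bigcup => z; rewrite /D; case: asboolP => _; last exact: borel0.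
pose A j : set R' :=
  `](ratr (z.1 0 j) - z.2.+1%:R^-1)%R, (ratr (z.1 0 j) + z.2.+1%:R^-1)%R[%classic.
have -> : box z = \bigcap_j [set s : V | A j (s 0 j)].
  apply/seteqP; split=> s h j.
    by move=> _; rewrite /A /mkset in_itv/= -ltr_distl; exact: h.
  by have := h j I; rewrite /A /mkset in_itv/= -ltr_distl.
by apply: borel_bigcap => j; apply: (@borel_coord j (A j)); exact: measurable_itv.
Qed.

End NullSets.

(** * Rademacher's theorem *)

Section Distance.
Variables (R : realType) (n : nat) (C : set 'rV[R]_n) (c0 : 'rV[R]_n).
Hypothesis Cc0 : C c0.

Definition edist (z : 'rV[R]_n) : R := inf [set enorm (z - c) | c in C].

Let dset_inf z : has_inf [set enorm (z - c) | c in C].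
Proof.
split; first by exists (enorm (z - c0)); exists c0.
by exists 0 => _ [c _ <-]; exact: enorm_ge0.
Qed.

Lemma edist_le z c : C c -> edist z <= enorm (z - c).
Proof. by move=> Cc; apply: ge_inf; [have [] := dset_inf z|exists c]. Qed.

Lemma edist_ge0 z : 0 <= edist z.
Proof.
apply: lb_le_inf; first by have [] := dset_inf z.
by move=> _ [c _ <-]; exact: enorm_ge0.
Qed.

Lemma edist0 z : C z -> edist z = 0.
Proof.
move=> Cz; apply/eqP; rewrite eq_le edist_ge0 andbT.
by have := edist_le z Cz; rewrite subrr enorm0.
Qed.

Lemma edist_lt z (e : R) : 0 < e -> exists c, C c /\ enorm (z - c) < edist z + e.
Proof.
move=> e0; have [_ [c Cc <-] h] := inf_adherent e0 (dset_inf z).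
by exists c.
Qed.

Lemma edist_lip x y : `|edist x - edist y| <= 1 * enorm (x - y).
Proof.
rewrite mul1r; have half u v : edist u - edist v <= enorm (u - v).
  apply/ler_addgt0Pr => e e0; have [c [Cc vc]] := edist_lt v e0.
  by have := edist_le u Cc; have := enorm_dist v u c; lra.
by rewrite ler_norml half andbT lerNl opprB enormBC half.
Qed.
End Distance.

(** Slopes valid up to [e] and [e'] satisfy [a - e <= a' + e'], so the supremum of all [a - e] is
    squeezed into being the derivative. This recovers a real derivative from rational slopes. *)
Lemma deriv1_of_approx (R : realType) (h : R -> R) (t : R) :
  (forall e : R, 0 < e -> exists a d, 0 < d /\
    forall s, `|s| < d -> `|h (t + s) - h t - a * s| <= e * `|s|) ->
  exists a, deriv1_at h t a.
Proof.
move=> H.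
pose A e a := exists d, 0 < d /\
    forall s, `|s| < d -> `|h (t + s) - h t - a * s| <= e * `|s|.
have key e a e' a' : A e a -> A e' a' -> a - e <= a' + e'.
  move=> [d [d0 hd]] [d' [d'0 hd']].
  have m0 : 0 < Num.min d d' by rewrite lt_min d0.
  pose s := Num.min d d' / 2.
  have s0 : 0 < s by rewrite divr_gt0.
  have sm : s < Num.min d d' by rewrite /s; lra.
  have ns : `|s| = s by rewrite gtr0_norm.
  have [sd sd'] : s < d /\ s < d' by move: sm; rewrite lt_min => /andP.
  have := hd s; have := hd' s; rewrite ns => /(_ sd') h1 /(_ sd) h2.
  rewrite -(ler_pM2r s0) mulrBl mulrDl.
  by move: h1 h2; rewrite !ler_norml => /andP[? ?] /andP[? ?]; lra.
pose S := [set b | exists e a, 0 < e /\ A e a /\ b = a - e].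
have [a1 Aa1] := H 1 ltr01.
have hS : has_sup S.
  split; first by exists (a1 - 1); exists 1, a1.
  by exists (a1 + 1) => _ [e [a [_ [Aa ->]]]]; exact: key Aa Aa1.
exists (sup S) => e e0; have e2 : 0 < e / 2 by rewrite divr_gt0.
have [a Aa] := H _ e2; have [d [d0 hd]] := Aa.
have lo : a - e / 2 <= sup S by apply: ub_le_sup; [have [] := hS|exists (e / 2), a].
have up : sup S <= a + e / 2.
  apply: ge_sup; first by have [] := hS.
  by move=> _ [e' [a' [_ [Aa' ->]]]]; exact: key Aa' Aa.
exists d; split=> // s /hd h1.
have -> : h (t + s) - h t - sup S * s = (h (t + s) - h t - a * s) + (a - sup S) * s by ring.
apply: le_trans (ler_normD _ _) _; rewrite normrM.
have : `|a - sup S| <= e / 2 by rewrite ler_norml; apply/andP; split; lra.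
by move=> /(ler_wpM2r (normr_ge0 s)); lra.
Qed.

Lemma ler_norm_sum5 (R : realDomainType) (a b c d e A B C D E : R) :
  `|a| <= A -> `|b| <= B -> `|c| <= C -> `|d| <= D -> `|e| <= E ->
  `|a + b + - c + d + e| <= A + B + C + D + E.
Proof.
move=> ha hb hc hd he; apply: le_trans (ler_normD _ _) (lerD _ he).
apply: le_trans (ler_normD _ _) (lerD _ hd).
by apply: le_trans (ler_normB _ _) (lerD (le_trans (ler_normD _ _) (lerD ha hb)) hc).
Qed.

Section Rademacher.
Variables (R : realType) (n : nat).
Local Notation V := 'rV[R]_n.
Local Notation ei i := (delta_mx 0 i : 'rV[R]_n).
Implicit Types (s y : V) (i j : 'I_n) (l : seq 'I_n) (f : V -> R).

Lemma upd_shift s i a : upd s i a = s + (a - s 0 i) *: ei i.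
Proof.
apply/rowP => k; rewrite !mxE/=; have [->|ki] := eqVneq k i.
  by rewrite mulr1 addrC subrK.
by rewrite mulr0 addr0.
Qed.

(** [z] codes precision, slope and scale. Countably many sets cover the points of differentiability,
    each with an estimate uniform over its points. *)
Definition slope_set f i (z : nat * rat * nat) : set V :=
  [set s | forall t : R, `|t| < z.2.+1%:R^-1 ->
    `|f (s + t *: ei i) - f s - ratr z.1.2 * t| <= z.1.1.+1%:R^-1 * `|t|].

Definition lipf f (L : R) := 0 < L /\ forall x y, `|f x - f y| <= L * enorm (x - y).

Lemma borel_slope_set f L i z : lipf f L -> borel (slope_set f i z).
Proof.
move=> [L0 fL]; rewrite -[X in borel X]setCK; apply: borelC; apply: borel_open => s.
move=> /existsNP[t /not_implyP[td /negP]]; rewrite -ltNge => ht.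
set g := `|_ - ratr _ * t| in ht.
(* Coordinates moving by less than [e] change the tested quantity by at most [2 * L * (n%:R * e)],
   strictly less than the gap thanks to [n.+1]. *)
pose e := (g - z.1.1.+1%:R^-1 * `|t|) / (2 * L * n.+1%:R).
have den0 : 0 < 2 * L * n.+1%:R by rewrite !mulr_gt0.
have e0 : 0 < e by rewrite divr_gt0// subr_gt0.
exists e; split=> // s' hs' hC; have := hC t td; apply/negP; rewrite -ltNge.
have ss' : enorm (s' - s) <= n%:R * e.
  apply: le_trans (enorm_le_sum _) _.
  have -> : n%:R * e = \sum_(j < n) e by rewrite sumr_const card_ord mulr_natl.
  by apply: ler_sum => j _; rewrite !mxE ltW.
have h1 := fL s' s; have h2 := fL (s' + t *: ei i) (s + t *: ei i).
rewrite (_ : s' + t *: ei i - (s + t *: ei i) = s' - s) in h2; last first.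
  by rewrite opprD addrACA subrr addr0.
have h3 : g <= `|f (s' + t *: ei i) - f s' - ratr z.1.2 * t| + 2 * L * (n%:R * e).
  have -> : g = `|(f (s' + t *: ei i) - f s' - ratr z.1.2 * t)
     - (f (s' + t *: ei i) - f (s + t *: ei i)) + (f s' - f s)|.
    by rewrite /g; congr (`|_|); ring.
  apply: le_trans (ler_normD _ _) _; apply: le_trans (lerD (ler_normB _ _) (lexx _)) _.
  have := ler_wpM2l (ltW L0) ss'; lra.
have h4 : 2 * L * (n%:R * e) < g - z.1.1.+1%:R^-1 * `|t|.
  have -> : g - z.1.1.+1%:R^-1 * `|t| = 2 * L * (n.+1%:R * e).
    by rewrite mulrA [RHS]mulrC /e divfK// gt_eqF.
  by rewrite ltr_pM2l ?mulr_gt0// ltr_pM2r// ltr_nat.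
move: h3 h4; move: (_^-1 * `|t|) (2 * L * _) `|_ - ratr _ * t| => a b c; lra.
Qed.

(* Partial differentiability in direction [i], written with countable quantifiers so that the
   set of such points is Borel. *)
Definition pdiff f i s := forall k, exists q m, slope_set f i (k, q, m) s.

Lemma pdiff_deriv1 f i s : pdiff f i s -> exists a, deriv1_at (fun t => f (s + t *: ei i)) 0 a.
Proof.
move=> hp; apply: deriv1_of_approx => e e0.
have [k hk] := ltr_add_invr e0; rewrite add0r in hk.
have [q [m hq]] := hp k.
exists (ratr q), (m.+1%:R^-1); split; first by rewrite invr_gt0.
move=> t tm; rewrite add0r scale0r addr0; apply: le_trans (hq t tm) _.
by rewrite ler_wpM2r// ltW.
Qed.

Lemma deriv1_pdiff f i s a : deriv1_at (fun t => f (s + t *: ei i)) 0 a -> pdiff f i s.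
Proof.
move=> ha k; pose c := k.+1%:R^-1 / 2 : R.
have c0 : 0 < c by rewrite divr_gt0.
have [d [d0 hd]] := ha c c0.
have [m hm] := ltr_add_invr d0; rewrite add0r in hm.
have lt1 : a - c < a + c by lra.
have [q] := rat_in_itvoo lt1; rewrite in_itv/= => /andP[q1 q2].
exists q, m => t /= /lt_trans/(_ hm)/hd; rewrite add0r scale0r addr0 => ht.
have -> : f (s + t *: ei i) - f s - ratr q * t =
  (f (s + t *: ei i) - f s - a * t) + (a - ratr q) * t by ring.
apply: le_trans (ler_normD _ _) _; rewrite normrM.
have -> : k.+1%:R^-1 = c + c :> R by rewrite /c -splitr.
have : `|a - ratr q| <= c by rewrite ler_norml; apply/andP; split; lra.
by move=> /(ler_wpM2r (normr_ge0 t)); lra.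
Qed.

(** Restricted to any line in direction [i], [f] is Lipschitz in one variable, so the bad set meets
    every such line in a null set and [null_line] applies. *)
Lemma ae_pdiff f L i : lipf f L -> ae_cube (pdiff f i).
Proof.
move=> fL; pose E := ~` [set s | pdiff f i s].
exists E; split=> [|s /contrapT//].
have bE : borel E.
  apply: borelC.
  have -> : [set s | pdiff f i s] = \bigcap_k \bigcup_q \bigcup_m slope_set f i (k, q, m).
    apply/seteqP; split=> s hs k; first by move=> _; have [q [m h]] := hs k; exists q => //; exists m.
    by have [q _ [m _ h]] := hs k I; exists q, m.
  apply: borel_bigcap => k; apply: borel_bigcup => q; apply: borel_bigcup => m.
  exact: borel_slope_set fL.
apply: (null_line (i := i)) => // s.
have hL (x y : R) : `|f (upd s i x) - f (upd s i y)| <= L * `|x - y|.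
  have [_ h] := fL; apply: le_trans (h _ _) _.
  rewrite !upd_shift opprD addrACA subrr add0r -scalerBl enormZ enorm_delta mulr1.
  by rewrite opprB addrA subrK.
have [L0 _] := fL.
have [g [_ _ _ [N [mN N0 hN]]]] := lipschitz_density L0 hL.
apply/eqP; rewrite -measure_le0 -N0; apply: le_measure; rewrite ?inE//.
  exact: borel_unit_section.
move=> a [/andP[a0 a1] nd]; apply: hN => /= h; apply: nd.
have ha := h a0 a1; apply: deriv1_pdiff (g a - L) _ => e e0.
have [d [d0 hd]] := ha e e0; exists d; split=> // t /hd.
have shift b : upd s i (a + b) = upd s i a + b *: ei i.
  by rewrite !upd_shift -[RHS]addrA -scalerDl; congr (_ + _ *: _); ring.
by rewrite add0r scale0r addr0 shift.
Qed.

Definition diff_along l f s := exists a : V, forall e : R, 0 < e -> exists d, 0 < d /\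
  forall y, (forall j, j \notin l -> y 0 j = 0) -> enorm y < d ->
    `|f (s + y) - f s - dotv a y| <= e * enorm y.

(* [edist C] is minimal at the points of [C], so its derivative vanishes there. *)
Lemma edist_flat l (C : set V) s : C s -> diff_along l (edist C) s ->
  forall e : R, 0 < e -> exists d, 0 < d /\
    forall y, (forall j, j \notin l -> y 0 j = 0) -> enorm y < d ->
      edist C (s + y) <= e * enorm y.
Proof.
move=> Cs [a ha] e e0; have e2 : 0 < e / 2 by rewrite divr_gt0.
have [d [d0 hd]] := ha _ e2; exists d; split=> // y yl yd.
have h1 := hd y yl yd.
have h2 : `|edist C (s - y) - edist C s - dotv a (- y)| <= e / 2 * enorm y.
  rewrite -(enormN y); apply: hd; rewrite ?enormN// => j jl.
  by rewrite mxE yl ?oppr0.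
have := edist_ge0 Cs (s - y); move: h1 h2; rewrite (edist0 Cs Cs) dotvNr.
by rewrite !ler_norml => /andP[? ?] /andP[? ?] ?; lra.
Qed.

(* Near almost every point [s] of a closed [slope_set], a displacement [y'] along [l] ends
   within [o(|y'|)] of the set, by differentiability of the distance function; the uniform
   estimate in the new direction [i] is then available from the end of [y']. *)
Lemma ae_diff_along l f L : uniq l -> lipf f L -> ae_cube (diff_along l f).
Proof.
elim: l f L => [|i l ih] f L /=.
  move=> _ _; exists set0; split; first exact: null0.
  move=> s _; exists 0 => e e0; exists 1; split=> // y hy _.
  have -> : y = 0 by apply/rowP => j; rewrite mxE hy.
  by rewrite addr0 subrr dotv0 subrr normr0 enorm0 mulr0.
move=> /andP[il ul] fL.
have h1 := ih f L ul fL; have h2 := ae_pdiff i fL.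
have h3 : ae_cube (fun s => forall z, slope_set f i z s -> diff_along l (edist (slope_set f i z)) s).
  apply: ae_cube_all => z.
  have [[c Cc]|ne] := pselect (exists c, slope_set f i z c).
    apply: ae_cube_imp (ih (edist (slope_set f i z)) 1 ul _) => //.
    by split=> //; exact: edist_lip Cc.
  exists set0; split; first exact: null0.
  by move=> s _ hs; case: ne; exists s.
apply: ae_cube_imp (ae_cube_and h1 (ae_cube_and h2 h3)) => s.
move=> [[a' ha'] [hp hz]]; have [al hal] := pdiff_deriv1 hp.
have [L0 hL] := fL.
(* As [i] is not in [l], the induction hypothesis leaves coordinate [i] of [a'] arbitrary; it is
   overwritten by the partial derivative [al]. *)
exists (a' + (al - a' 0 i) *: ei i) => e e0.
(* The five errors added at the end are [5 * L * r], [r], [5 * L * r], [2 * r] and [2 * r], each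
   times [enorm y]. *)
pose r := e / (10 * L + 5).
have r0 : 0 < r by rewrite divr_gt0//; lra.
have re : (10 * L + 5) * r = e by rewrite mulrC divfK// gt_eqF//; lra.
have [k hk] := ltr_add_invr r0; rewrite add0r in hk.
have [q [m Cs]] := hp k; set C := slope_set _ _ _ in Cs.
have m0 : 0 < m.+1%:R^-1 :> R by rewrite invr_gt0.
have Cr c : C c -> forall t : R, `|t| < m.+1%:R^-1 ->
    `|f (c + t *: ei i) - f c - ratr q * t| <= r * `|t|.
  move=> Cc t tm; apply: le_trans (Cc t tm) _.
  by rewrite ler_wpM2r//= ltW.
have qal : `|ratr q - al| <= 2 * r.
  have [d [d0 hd]] := hal r r0.
  have mm0 : 0 < Num.min d m.+1%:R^-1 by rewrite lt_min d0.
  pose t := Num.min d m.+1%:R^-1 / 2.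
  have t0 : 0 < t by rewrite divr_gt0.
  have tm : t < Num.min d m.+1%:R^-1 by rewrite /t; lra.
  have nt : `|t| = t by rewrite gtr0_norm.
  have [td tm'] : t < d /\ t < m.+1%:R^-1 by move: tm; rewrite lt_min => /andP.
  have := hd t; have := Cr s Cs t; rewrite nt add0r scale0r addr0 => /(_ tm') g1 /(_ td) g2.
  rewrite -(ler_pM2r t0) -{1}nt -normrM.
  have -> : (ratr q - al) * t = (f (s + t *: ei i) - f s - al * t)
    - (f (s + t *: ei i) - f s - ratr q * t) by ring.
  apply: le_trans (ler_normB _ _) _.
  by lra.
have r2 : 0 < 2 * r by rewrite mulr_gt0.
have [d1 [d10 hd1]] := ha' r r0.
have [d2 [d20 hd2]] := edist_flat Cs (hz _ Cs) r2.
pose d := Num.min (m.+1%:R^-1) (Num.min d1 d2 / 2).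
exists d; split; first by rewrite lt_min m0 divr_gt0// lt_min d10.
move=> y hy; rewrite /d lt_min => /andP[ym].
rewrite ltr_pdivlMr// mulrC lt_min => /andP[yd1 yd2].
have [->|y0] := eqVneq y 0.
  by rewrite addr0 subrr dotv0 subrr normr0 enorm0 mulr0.
have {}y0 : 0 < enorm y by rewrite enorm_gt0.
pose t := y 0 i; pose y' := y - t *: ei i.
have ty : `|t| <= enorm y by exact: coord_le_enorm.
have yE : y = y' + t *: ei i by rewrite subrK.
have y'y : enorm y' <= 2 * enorm y.
  by apply: le_trans (enormB _ _) _; rewrite enormZ enorm_delta mulr1; lra.
have y'i : y' 0 i = 0 by rewrite !mxE !eqxx mulr1 subrr.
have hy' j : j \notin l -> y' 0 j = 0.
  move=> jl; have [->//|ji] := eqVneq j i.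
  by rewrite !mxE (negPf ji) andbF mulr0 subr0 hy// inE negb_or ji.
have g1 := hd1 y' hy' (le_lt_trans y'y yd1).
have g2 := hd2 y' hy' (le_lt_trans y'y yd2).
have [c [Cc hc]] := edist_lt Cs (s + y') (mulr_gt0 r0 y0).
have hc' : enorm (s + y' - c) <= 5 * r * enorm y.
  have := ler_wpM2l (ltW r2) y'y; lra.
have g3 := Cr c Cc t (le_lt_trans ty ym).
have g4 := hL (s + y') c.
have g5 := hL (s + y) (c + t *: ei i).
rewrite (_ : s + y - (c + t *: ei i) = s + y' - c) in g5; last first.
  by rewrite {1}yE addrA opprD addrACA subrr addr0.
have dE : dotv (a' + (al - a' 0 i) *: ei i) y = dotv a' y' + al * t.
  have dei u : dotv (ei i) u = u 0 i.
    rewrite /dotv (bigD1 i)//= big1 => [|j ji]; rewrite mxE eqxx ?eqxx/= ?mul1r ?addr0//.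
    by rewrite (negPf ji) mul0r.
  rewrite dotvDl dotvZl dei -/t {1}yE dotvDr dotvZr (dotvC a' (ei i)) dei; ring.
rewrite dE.
(* The route from [s] to [s + y] goes along [y'], jumps to the nearby point [c] of [C], follows
   direction [i] with slope [q], and jumps back; the last term exchanges [q] for [al]. *)
have -> : f (s + y) - f s - (dotv a' y' + al * t) =
   (f (s + y) - f (c + t *: ei i)) + (f (c + t *: ei i) - f c - ratr q * t)
   + - (f (s + y') - f c) + (f (s + y') - f s - dotv a' y') + (ratr q - al) * t by ring.
have b1 : `|f (s + y) - f (c + t *: ei i)| <= 5 * (L * r * enorm y).
  by apply: le_trans g5 _; have := ler_wpM2l (ltW L0) hc'; lra.
have b2 := le_trans g3 (ler_wpM2l (ltW r0) ty).
have b3 : `|f (s + y') - f c| <= 5 * (L * r * enorm y).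
  by apply: le_trans g4 _; have := ler_wpM2l (ltW L0) hc'; lra.
have b4 := le_trans g1 (ler_wpM2l (ltW r0) y'y).
have b5 : `|(ratr q - al) * t| <= 2 * (r * enorm y).
  rewrite normrM; have := ler_wpM2r (normr_ge0 t) qal.
  by have := ler_wpM2l (ltW r0) ty; lra.
apply: le_trans (ler_norm_sum5 b1 b2 b3 b4 b5) _.
by rewrite -re le_eqVlt; apply/orP; left; apply/eqP; ring.
Qed.

Lemma ae_jacobian (G : V -> V) (L : R) : 0 < L ->
  (forall x y, enorm (G x - G y) <= L * enorm (x - y)) ->
  ae_cube (fun s => exists J, has_jacobian G s J).
Proof.
move=> L0 GL.
have Gi i : lipf (fun x => G x 0 i) L.
  split=> // x y; apply: le_trans (GL x y).
  by have := coord_le_enorm (G x - G y) i; rewrite !mxE.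
have : ae_cube (fun s => forall i, diff_along (enum 'I_n) (fun x => G x 0 i) s).
  by apply: ae_cube_all => i; exact: ae_diff_along (enum_uniq _) (Gi i).
apply: ae_cube_imp => s /choice[a ha].
exists (\matrix_(i, j) a i 0 j) => e e0.
have e0' : 0 < e / n.+1%:R by rewrite divr_gt0.
have /choice[d hd] : forall i, exists d, 0 < d /\ forall y, enorm y < d ->
    `|G (s + y) 0 i - G s 0 i - dotv (a i) y| <= e / n.+1%:R * enorm y.
  move=> i; have [d [d0 hd]] := ha i _ e0'; exists d; split=> // y.
  by apply: hd => j; rewrite mem_enum.
(* The default 1 keeps the radius positive when there are no coordinates. *)
exists (\big[Num.min/1]_i d i); split.
  by elim/big_ind: _ => // [x y x0 y0|i _]; [rewrite lt_min x0|have [] := hd i].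
move=> z zd; apply: le_trans (enorm_le_sum _) _.
have -> : e * enorm (z - s) = \sum_(i < n.+1) (e / n.+1%:R * enorm (z - s)).
  by rewrite sumr_const card_ord -mulrnAl -mulr_natr divfK// pnatr_eq0.
rewrite big_ord_recr/= -[leLHS]addr0; apply: lerD; last first.
  by rewrite mulr_ge0 ?enorm_ge0// ltW.
apply: ler_sum => i _; have [_ h] := hd i.
have zi : enorm (z - s) < d i by apply: lt_le_trans zd _; exact: bigmin_le.
have := h _ zi; rewrite [s + _]addrC subrK; congr (_ <= _); congr (`|_|).
rewrite !mxE; congr (_ - _); apply: eq_bigr => j _.
by rewrite !mxE mulrC.
Qed.

End Rademacher.

(** * A mean value inequality for Jacobians *)

Section MeanValue.
Variables (R : realType) (n : nat).
Local Notation V := 'rV[R]_n.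
Local Notation ei i := (delta_mx 0 i : 'rV[R]_n).

Lemma mxappD (A : 'M[R]_n) (u v : V) : mxapp A (u + v) = mxapp A u + mxapp A v.
Proof. by rewrite /mxapp mulmxDl. Qed.

Lemma mxappZ (A : 'M[R]_n) a (u : V) : mxapp A (a *: u) = a *: mxapp A u.
Proof. by rewrite /mxapp scalemxAl. Qed.

Lemma mxappB (A : 'M[R]_n) (u v : V) : mxapp A (u - v) = mxapp A u - mxapp A v.
Proof. by rewrite /mxapp mulmxBl. Qed.

Lemma mxappN (A : 'M[R]_n) (u : V) : mxapp A (- u) = - mxapp A u.
Proof. by rewrite /mxapp mulNmx. Qed.

Lemma has_jacobian_ray (G : V -> V) z J (u : V) (e : R) : has_jacobian G z J -> 0 < e ->
  exists d, 0 < d /\ forall t : R, `|t| < d ->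
    enorm (G (z + t *: u) - G z - t *: mxapp J u) <= e * `|t|.
Proof.
move=> hJ e0; have c0 : 0 < enorm u + 1 by have := enorm_ge0 u; lra.
have e0' : 0 < e / (enorm u + 1) by rewrite divr_gt0.
have [d [d0 hd]] := hJ _ e0'; exists (d / (enorm u + 1)); split; first by rewrite divr_gt0.
move=> t td; have zt : z + t *: u - z = t *: u by rewrite addrAC subrr add0r.
have tu : enorm (t *: u) <= `|t| * (enorm u + 1).
  by rewrite enormZ ler_wpM2l// lerDl.
have := hd (z + t *: u) _; rewrite zt mxappZ => h.
apply: le_trans (h _) _.
  by apply: le_lt_trans tu _; rewrite -ltr_pdivlMr.
apply: le_trans (ler_wpM2l (ltW e0') tu) _.
by rewrite mulrCA divfK ?gt_eqF// mulrC.
Qed.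

Lemma has_jacobian_bound (G : V -> V) (L : R) z J (u : V) :
  (forall x y, enorm (G x - G y) <= L * enorm (x - y)) ->
  has_jacobian G z J -> enorm (mxapp J u) <= L * enorm u.
Proof.
move=> GL hJ; apply/ler_addgt0Pr => e e0.
have [d [d0 hd]] := has_jacobian_ray u hJ e0.
have t0 : 0 < d / 2 by rewrite divr_gt0.
have nt : `|d / 2| = d / 2 by rewrite gtr0_norm.
have lt2 : d / 2 < d by lra.
have := hd (d / 2); rewrite nt => /(_ lt2) h1.
rewrite -(ler_pM2l t0) -{1}nt -enormZ.
have h2 := GL (z + (d / 2) *: u) z.
rewrite [X in L * enorm X]addrAC subrr add0r enormZ nt in h2.
have := enormB (G (z + (d / 2) *: u) - G z)
  (G (z + (d / 2) *: u) - G z - (d / 2) *: mxapp J u).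
by rewrite opprB addrC subrK; lra.
Qed.

Lemma has_jacobian_local (G H : V -> V) z J (r : R) : 0 < r ->
  (forall y, enorm (y - z) < r -> G y = H y) -> has_jacobian G z J -> has_jacobian H z J.
Proof.
move=> r0 GH hJ e e0; have [d [d0 hd]] := hJ e e0.
exists (Num.min d r); split; first by rewrite lt_min d0.
move=> y; rewrite lt_min => /andP[yd yr].
by rewrite -(GH y yr) -(GH z) ?subrr ?enorm0//; exact: hd.
Qed.

(** * Jacobians under a shear *)

Section Sheared.
Variables (x d : V) (i : 'I_n) (tau : R).
Hypothesis tau0 : 0 < tau.
Hypothesis dtau : d 0 i + tau != 0.

(* Maps lines in direction [i] to lines almost parallel to [d]. *)
Definition shear (s : V) : V := x + (s 0 i *: d + tau *: s).

(** Sherman-Morrison inverse of the linear part of [shear], a rank-one perturbation of [tau] times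
    the identity, acting on row vectors. *)
Let Bt : 'M[R]_n := tau^-1 *: (1%:M - (d 0 i + tau)^-1 *: (delta_mx i 0 *m d)).

Let unshear (w : V) : V := tau^-1 *: (w - (w 0 i / (d 0 i + tau)) *: d).

Let BtE w : w *m Bt = unshear w.
Proof.
rewrite /Bt -scalemxAr mulmxBr mulmx1 -scalemxAr mulmxA -colE.
have -> : col i w = (w 0 i)%:M by apply/matrixP => a b; rewrite !ord1 !mxE eqxx mulr1n.
by rewrite mul_scalar_mx scalerA mulrC.
Qed.

Let shear_unshear s w : shear (s + unshear w) = shear s + w.
Proof.
rewrite /shear -!addrA; congr (_ + _); rewrite !addrA.
apply/rowP => j; rewrite !mxE.
have t0 : tau != 0 by rewrite gt_eqF.
by field; rewrite t0 dtau.
Qed.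

(** Chain rule through the inverse shear: the derivative along a coordinate line upstairs is that of
    [G] along [d], up to a term of order [tau]. *)
Lemma shear_jacobian (G : V -> V) s K : has_jacobian (fun s => G (shear s)) s K ->
  exists J, has_jacobian G (shear s) J /\
    mxapp K (ei i) = mxapp J d + tau *: mxapp J (ei i).
Proof.
move=> hK; exists (K *m Bt^T).
have JE w : mxapp (K *m Bt^T) w = mxapp K (unshear w).
  by rewrite /mxapp trmx_mul trmxK mulmxA BtE.
split; last first.
  rewrite !JE -mxappZ -mxappD; congr mxapp; apply/rowP => j; rewrite !mxE !eqxx /=.
  have t0 : tau != 0 by rewrite gt_eqF.
  by field; rewrite t0 dtau.
pose M := tau^-1 * (1 + enorm d / `|d 0 i + tau|).
have Mge w : enorm (unshear w) <= M * enorm w.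
  rewrite enormZ gtr0_norm ?invr_gt0// -mulrA ler_pM2l ?invr_gt0//.
  apply: le_trans (enormB _ _) _; rewrite enormZ normrM normfV mulrDl mul1r lerD2l.
  rewrite [leRHS]mulrC [leLHS]mulrAC -mulrA.
  by apply: ler_wpM2r; rewrite ?coord_le_enorm// divr_ge0 ?enorm_ge0.
have M0 : 0 < M.
  by rewrite mulr_gt0 ?invr_gt0// ltr_pwDl// divr_ge0 ?enorm_ge0.
move=> e e0; have e0' : 0 < e / M by rewrite divr_gt0.
have [r [r0 hr]] := hK _ e0'; exists (r / M); split; first by rewrite divr_gt0.
move=> z zr; set w := z - shear s in zr *.
have := hr (s + unshear w).
rewrite [s + _ - _]addrAC subrr add0r shear_unshear JE [shear s + w]addrC subrK => h.
apply: le_trans (h _) _.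
  by apply: le_lt_trans (Mge w) _; rewrite mulrC -ltr_pdivlMr.
apply: le_trans (ler_wpM2l (ltW e0') (Mge w)) _.
by rewrite mulrA divfK// gt_eqF.
Qed.

End Sheared.

(** Were the bound to fail for all Jacobians near the segment, the scalar function [h] on a sheared
    line avoiding the bad set almost everywhere would grow by more than its end values allow. *)
Lemma lipschitz_jacobian_mean_value (G : V -> V) (L : R) (x d p : V) (eta : R) (i : 'I_n) :
  0 < L -> (forall x y, enorm (G x - G y) <= L * enorm (x - y)) -> 0 < eta ->
  exists z J, [/\ has_jacobian G z J, enorm (z - x) <= enorm d + eta &
    dotv p (mxapp J d) <= dotv p (G (x + d) - G x) + eta].
Proof.
move=> L0 GL eta0.
have nge0 : 0 <= n%:R :> R by [].
have pge0 := enorm_ge0 p.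
(* Error budget per unit of [tau]: 1 for the part of the sheared direction off [d], [n] for the
   displacement of each endpoint, a further [n] for the distance to the segment, and 1 for
   positivity. *)
pose c := enorm p * L * (1 + 2 * n%:R) + n%:R + 1.
have c0 : 0 < c.
  have : 0 <= enorm p * L * (1 + 2 * n%:R) by rewrite !mulr_ge0 ?(ltW L0)//; lra.
  by rewrite /c; lra.
(* Invertibility of the shear excludes a single value of [tau], so one of two candidates works. *)
have [tau [tau0 tauc dtau]] : exists tau, [/\ 0 < tau, tau * c < eta & d 0 i + tau != 0].
  pose a := eta / c; have a0 : 0 < a by rewrite divr_gt0.
  have ac : a * c = eta by rewrite divfK// gt_eqF.
  have [h|h] := eqVneq (d 0 i + a / 2) 0; last first.
    by exists (a / 2); split=> //; [rewrite divr_gt0|lra].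
  exists (a / 3); split; [by rewrite divr_gt0|lra|].
  by apply/eqP => h'; lra.
pose H s := G (shear x d i tau s).
have shearB s s' : shear x d i tau s - shear x d i tau s' =
    (s 0 i - s' 0 i) *: d + tau *: (s - s').
  by rewrite /shear; apply/rowP => j; rewrite !mxE; ring.
pose LH := L * (enorm d + tau).
have LH0 : 0 < LH by rewrite mulr_gt0// ltr_wpDl ?enorm_ge0.
have HL s s' : enorm (H s - H s') <= LH * enorm (s - s').
  apply: le_trans (GL _ _) _; rewrite /LH -mulrA ler_pM2l// shearB.
  apply: le_trans (enormD _ _) _; rewrite !enormZ (gtr0_norm tau0) mulrDl lerD2r mulrC.
  rewrite ler_wpM2l ?enorm_ge0//.
  by have := coord_le_enorm (s - s') i; rewrite !mxE.
have [E [nE hE]] := ae_jacobian LH0 HL.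
have [s [scube sec0]] := null_line_witness i nE.
apply: contrapT => hno.
pose h t := dotv p (H (upd s i t)).
have us t t' : upd s i t - upd s i t' = (t - t') *: ei i.
  by rewrite !upd_shift; apply/rowP => j; rewrite !mxE; ring.
have hL t t' : `|h t - h t'| <= (enorm p * LH + 1) * `|t - t'|.
  rewrite /h -dotvBr; apply: le_trans (norm_dotv_le _ _) _.
  have := HL (upd s i t) (upd s i t'); rewrite us enormZ enorm_delta mulr1 => h1.
  have := ler_wpM2l pge0 h1; have := normr_ge0 (t - t'); lra.
have LH1 : 0 < enorm p * LH + 1 by rewrite ltr_wpDl// mulr_ge0// ltW.
have snorm (s' : V) : (forall j, 0 <= s' 0 j <= 1) -> enorm s' <= n%:R.
  move=> hs; apply: le_trans (enorm_le_sum _) _.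
  rewrite -[in leRHS](card_ord n) -sumr_const; apply: ler_sum => j _.
  by have /andP[? ?] := hs j; rewrite ger0_norm.
have unorm t : 0 <= t -> t <= 1 -> enorm (upd s i t) <= n%:R.
  move=> t0 t1; apply: snorm => j; rewrite mxE; case: eqP => _; first by rewrite t0.
  by have /andP[? ?] := scube j; rewrite !ltW.
have shn t : 0 <= t -> t <= 1 -> enorm (shear x d i tau (upd s i t) - (x + t *: d)) <= tau * n%:R.
  move=> t0 t1; rewrite /shear mxE eqxx opprD addrACA subrr add0r addrAC subrr add0r.
  by rewrite enormZ (gtr0_norm tau0) ler_wpM2l ?unorm// ltW.
pose cc := dotv p (G (x + d) - G x) + eta - tau * (enorm p * L).
have : cc <= h 1 - h 0.
  apply: (@lipschitz_mean_value R h (enorm p * LH + 1) cc (unit_section s i E)) => //.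
    apply/negligibleP => //; apply: borel_unit_section; by have [] := nE.
  move=> t t0 t1 Zt.
  have [|K hK] := hE (upd s i t).
    by move=> Et; apply: Zt; split=> //; rewrite t0.
  have [J [hJ KE]] := shear_jacobian tau0 dtau hK.
  exists (dotv p (mxapp K (ei i))); split.
    rewrite leNgt; apply/negP => hlt; apply: hno.
    exists (shear x d i tau (upd s i t)), J; split=> //.
      have := shn t (ltW t0) (ltW t1).
      have : enorm (t *: d) <= enorm d.
        by rewrite enormZ gtr0_norm// ler_piMl ?enorm_ge0// ltW.
      have := enorm_dist (x + t *: d) (shear x d i tau (upd s i t)) x.
      rewrite [x + t *: d - x]addrAC subrr add0r.
      have : tau * n%:R <= tau * c.
        rewrite ler_pM2l// /c.
        have : 0 <= enorm p * L * (1 + 2 * n%:R) by rewrite !mulr_ge0 ?(ltW L0)//; lra.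
        lra.
      lra.
    move: hlt; rewrite KE dotvDr dotvZr /cc.
    have := norm_dotv_le p (mxapp J (ei i)).
    have := has_jacobian_bound (ei i) GL hJ; rewrite enorm_delta mulr1 => h1.
    have := ler_wpM2l pge0 h1 => h2 h3.
    have {h2 h3} := le_trans h3 h2; rewrite ler_norml => /andP[h2 _].
    have := ler_wpM2l (ltW tau0) h2; lra.
  move=> e e0; have e0' : 0 < e / (enorm p + 1) by rewrite divr_gt0// ltr_wpDl.
  have [r [r0 hr]] := has_jacobian_ray (ei i) hK e0'.
  exists r; split=> // b br; rewrite /h.
  have -> : upd s i (t + b) = upd s i t + b *: ei i.
    by rewrite !upd_shift -[RHS]addrA -scalerDl; congr (_ + _ *: _); ring.
  have -> : forall a b' c' : V, dotv p a - dotv p b' - dotv p c' * b = dotv p (a - b' - b *: c').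
    by move=> a b' c'; rewrite !dotvBr dotvZr [b * _]mulrC.
  apply: le_trans (norm_dotv_le _ _) _; apply: le_trans (ler_wpM2l pge0 (hr b br)) _.
  rewrite mulrA ler_wpM2r// mulrCA -[leRHS]mulr1 ler_pM2l// ler_pdivrMr ?mul1r ?lerDl//.
  by rewrite ltr_wpDl.
rewrite /h -dotvBr.
have b1 := shn 1 ler01 (lexx _); have b0 := shn 0 (lexx _) ler01.
rewrite scale1r in b1; rewrite scale0r addr0 in b0.
have := GL (shear x d i tau (upd s i 1)) (x + d); have := GL (shear x d i tau (upd s i 0)) x.
move=> /le_trans/(_ (ler_wpM2l (ltW L0) b0)) g0 /le_trans/(_ (ler_wpM2l (ltW L0) b1)) g1.
have f0 := le_trans (norm_dotv_le p _) (ler_wpM2l pge0 g0).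
have f1 := le_trans (norm_dotv_le p _) (ler_wpM2l pge0 g1).
move: f0 f1; rewrite !ler_norml !dotvBr => /andP[f0 _] /andP[_ f1].
rewrite /cc dotvBr /H; move: tauc f0 f1; rewrite /c; nra.
Qed.

End MeanValue.

(** * Jacobians along the graphical derivative *)

Section Limits.
Variables (R : realType) (n : nat).
Local Notation V := 'rV[R]_n.

Lemma seq_cvg_dotv_le (a : nat -> V) (l p : V) (c K : R) : seq_cvg a l ->
  (forall k, dotv p (a k) <= c + K * k.+1%:R^-1) -> dotv p l <= c.
Proof.
move=> al hp; apply/ler_addgt0Pr => e e0.
have c0 : 0 < enorm p + `|K| + 1 by have := enorm_ge0 p; have := normr_ge0 K; lra.
pose r := e / (enorm p + `|K| + 1).
have r0 : 0 < r by rewrite divr_gt0.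
have re : (enorm p + `|K| + 1) * r = e by rewrite mulrC divfK// gt_eqF.
have [N hN] := al r r0; have [m hm] := ltr_add_invr r0; rewrite add0r in hm.
pose k := maxn N m.
have h1 := hN k (leq_maxl _ _); have h2 := hp k.
have h3 := dotv_le_enorm p (l - a k); rewrite dotvBr enormBC in h3.
have h4 := ler_wpM2l (enorm_ge0 p) (ltW h1).
have h5 : K * k.+1%:R^-1 <= `|K| * r.
  apply: le_trans (ler_norm _) _; rewrite normrM ler_wpM2l// ger0_norm ?invr_ge0//.
  by apply: le_trans (ltW hm); rewrite lef_pV2 ?posrE// ler_nat ltnS leq_maxr.
move: h5; move: (K * _) h2 => Kk h2 h5; lra.
Qed.

Lemma enorm_mxapp (A : 'M[R]_n) (v : V) : enorm (mxapp A v) <= n%:R * (mxnorm A * enorm v).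
Proof.
apply: le_trans (enorm_le_sum _) _.
have -> : n%:R * (mxnorm A * enorm v) = \sum_(i < n) (mxnorm A * enorm v).
  by rewrite sumr_const card_ord mulr_natl.
apply: ler_sum => i _.
have -> : mxapp A v 0 i = dotv (row i A) v.
  by rewrite !mxE; apply: eq_bigr => j _; rewrite !mxE mulrC.
apply: le_trans (norm_dotv_le _ _) _; rewrite ler_wpM2r ?enorm_ge0//.
apply: ler_wsqrtr; rewrite (bigD1 i)//= /dotv.
have -> : \sum_(j < n) row i A 0 j * row i A 0 j = \sum_(j < n) A i j ^+ 2.
  by apply: eq_bigr => j _; rewrite !mxE expr2.
by rewrite lerDl; apply: sumr_ge0 => k _; apply: sumr_ge0 => j _; rewrite sqr_ge0.
Qed.

Lemma mseq_cvg_mxapp (J : nat -> 'M[R]_n) (A : 'M[R]_n) (v : V) : mseq_cvg J A ->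
  seq_cvg (fun k => mxapp (J k) v) (mxapp A v).
Proof.
move=> JA e e0.
have c0 : 0 < n%:R * enorm v + 1 by rewrite ltr_wpDl// mulr_ge0// enorm_ge0.
have [N hN] := JA _ (divr_gt0 e0 c0); exists N => k /hN h.
have -> : mxapp (J k) v - mxapp A v = mxapp (J k - A) v.
  by rewrite /mxapp -mulmxBr [(J k - A)^T]raddfB.
apply: le_lt_trans (enorm_mxapp _ _) _.
have m0 : 0 <= mxnorm (J k - A) by exact: sqrtr_ge0.
move: h; rewrite ltr_pdivlMr//.
have := mulr_ge0 (ler0n R n) (enorm_ge0 v); nra.
Qed.

(** Bolzano-Weierstrass on vectorised matrices. The bound [k <= sub k] is enough to carry limits
    over, so [sub] is picked by choice without making it increasing. *)
Lemma jacobian_subsequence (J : nat -> 'M[R]_n) (B : R) :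
  (forall k i j, `|J k i j| <= B) ->
  exists A (sub : nat -> nat), (forall k, (k <= sub k)%N) /\
    mseq_cvg (fun k => J (sub k)) A.
Proof.
move=> JB; pose v k : 'rV[R]_(n * n) := mxvec (J k).
have vB k : enorm (v k) <= (n * n)%:R * B.
  apply: le_trans (enorm_le_sum _) _; rewrite mulr_natl -[in leRHS](card_ord (n * n)).
  rewrite -sumr_const; apply: ler_sum => ij _.
  by case/mxvec_indexP: ij => i j; rewrite mxvecE.
have [w [_ cw]] : [set u | enorm u <= (n * n)%:R * B] `&` cluster (v @ \oo) !=set0.
  apply: compact_enorm_ball; by exists 0%N => // k _; exact: vB.
have ex k : exists m, (k <= m)%N /\ mxnorm (J m - vec_mx w) < k.+1%:R^-1.
  have e0 : 0 < (n%:R + 1)^-1 * k.+1%:R^-1 :> R by rewrite mulr_gt0 ?invr_gt0// ltr_wpDl.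
  have := cw [set v m | m in [set m | (k <= m)%N]] [set y | enorm (y - w) < (n%:R + 1)^-1 * k.+1%:R^-1].
  case=> [||_ [[m km <-]] /= h].
  - by exists k => // m km; exists m.
  - exact: enorm_ball_nbhs.
  exists m; split=> //.
  have n1 : 0 < n%:R + 1 :> R by rewrite ltr_wpDl.
  apply: le_lt_trans (_ : n%:R * enorm (v m - w) < _); last first.
    rewrite ltr_pdivlMl// in h; apply: le_lt_trans h.
    by rewrite ler_wpM2r ?enorm_ge0// lerDl.
  rewrite -[leRHS]ger0_norm ?mulr_ge0 ?enorm_ge0// -sqrtr_sqr; apply: ler_wsqrtr.
  have -> : (n%:R * enorm (v m - w)) ^+ 2 = \sum_(i < n) \sum_(j < n) enorm (v m - w) ^+ 2.
    by rewrite !sumr_const !card_ord -[RHS]mulr_natr -[X in _ = X * _]mulr_natr; ring.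
  apply: ler_sum => i _; apply: ler_sum => j _.
  rewrite -real_normK ?num_real// ler_pXn2r ?nnegrE ?enorm_ge0//.
  have -> : (J m - vec_mx w) i j = (v m - w) 0 (mxvec_index i j).
    by rewrite -[w in RHS]vec_mxK /v -linearB/= mxvecE.
  exact: coord_le_enorm.
have [sub hs] := choice ex.
exists (vec_mx w), sub; split; first by move=> k; have [] := hs k.
move=> e e0; have [m hm] := ltr_add_invr e0; rewrite add0r in hm.
exists m => k mk; have [_ h] := hs k; apply: lt_trans h _; apply: le_lt_trans hm.
by rewrite lef_pV2 ?posrE// ler_nat ltnS.
Qed.

(** For [0 <= a], the projection onto [[b - a, b + a]]. Applied coordinatewise it is a nonexpansive
    retraction onto a cube, which extends a locally Lipschitz map to the whole space. *)
Definition clamp (b a t : R) : R := b + Num.max (- a) (Num.min a (t - b)).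

Lemma clamp_lip b a (t s : R) : `|clamp b a t - clamp b a s| <= `|t - s|.
Proof.
have lip_max (c x y : R) : `|Num.max c x - Num.max c y| <= `|x - y|.
  have half u v : Num.max c u - Num.max c v <= `|u - v|.
    have := ler_norm (u - v); have := normr_ge0 (u - v); move: `|u - v| => N.
    by rewrite !maxEle; case: (leP c u) => ?; case: (leP c v) => ? ? ?; lra.
  by rewrite ler_norml half andbT lerNl opprB distrC half.
have lip_min (c x y : R) : `|Num.min c x - Num.min c y| <= `|x - y|.
  have half u v : Num.min c u - Num.min c v <= `|u - v|.
    have := ler_norm (u - v); have := normr_ge0 (u - v); move: `|u - v| => N.
    by rewrite !minEle; case: (leP c u) => ?; case: (leP c v) => ? ? ?; lra.
  by rewrite ler_norml half andbT lerNl opprB distrC half.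
rewrite /clamp opprD addrACA subrr add0r.
apply: le_trans (lip_max _ _ _) _; apply: le_trans (lip_min _ _ _) _.
by rewrite opprB addrA subrK.
Qed.

Definition vclamp (b : V) (a : R) (z : V) : V := \row_i clamp (b 0 i) a (z 0 i).

Lemma enorm_le_coord (u v : V) : (forall i, `|u 0 i| <= `|v 0 i|) -> enorm u <= enorm v.
Proof.
move=> uv; apply: ler_wsqrtr; apply: ler_sum => i _.
by rewrite -!expr2 -[leLHS]real_normK ?num_real// -[leRHS]real_normK ?num_real// ler_pXn2r ?nnegrE.
Qed.

Lemma vclamp_lip b a z w : enorm (vclamp b a z - vclamp b a w) <= enorm (z - w).
Proof. by apply: enorm_le_coord => i; rewrite !mxE clamp_lip. Qed.

Lemma vclamp_id b a z : enorm (z - b) <= a -> vclamp b a z = z.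
Proof.
move=> zb; apply/rowP => i; rewrite mxE /clamp.
have := le_trans (coord_le_enorm (z - b) i) zb; rewrite !mxE ler_norml => /andP[h1 h2].
by rewrite (min_idPr h2) (max_idPr h1); ring.
Qed.

Lemma vclamp_near b a z : 0 <= a -> enorm (vclamp b a z - b) <= n%:R * a.
Proof.
move=> a0; apply: le_trans (enorm_le_sum _) _.
rewrite mulr_natl -[in leRHS](card_ord n) -sumr_const; apply: ler_sum => i _.
rewrite !mxE /clamp addrAC subrr add0r ler_norml le_max lexx/=.
by rewrite ge_max ge_min lexx/= andbT; lra.
Qed.

End Limits.

(** * Strongly monotone Lipschitz maps and their generalized derivatives *)

Section Final.
Variables (R : realType) (n : nat) (g : 'rV[R]_n -> 'rV[R]_n) (xb : 'rV[R]_n).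
Variables (kappa rho L : R).
Hypothesis kappa0 : 0 < kappa.
Hypothesis rho0 : 0 < rho.
Hypothesis L0 : 0 < L.
Hypothesis gL : forall x y, enorm (x - xb) < rho -> enorm (y - xb) < rho ->
  enorm (g x - g y) <= L * enorm (x - y).
Hypothesis g_mono : forall x y, enorm (x - xb) < rho -> enorm (y - xb) < rho ->
  enorm (x - y) ^+ 2 <= kappa * dotv (g x - g y) (x - y).

Lemma ball_ray x u : enorm (x - xb) < rho ->
  exists d, 0 < d /\ forall t, 0 < t -> t < d -> enorm (x + t *: u - xb) < rho.
Proof.
move=> xr; have u1 : 0 < enorm u + 1 by rewrite ltr_wpDl ?enorm_ge0.
exists ((rho - enorm (x - xb)) / (enorm u + 1)); split.
  by rewrite divr_gt0// subr_gt0.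
move=> t t0; rewrite ltr_pdivlMr// => ht.
by have := enormD (x - xb) (t *: u); rewrite addrAC enormZ gtr0_norm//; lra.
Qed.

Lemma has_jacobian_mono z J u : enorm (z - xb) < rho -> has_jacobian g z J ->
  enorm u ^+ 2 <= kappa * dotv u (mxapp J u).
Proof.
move=> zr hJ; apply/ler_addgt0Pr => e e0.
have c0 : 0 < kappa * (enorm u + 1) by rewrite mulr_gt0// ltr_wpDl ?enorm_ge0.
have [d [d0 hd]] := has_jacobian_ray u hJ (divr_gt0 e0 c0).
have [r [r0 hr]] := ball_ray u zr.
pose t := Num.min d r / 2.
have m0 : 0 < Num.min d r by rewrite lt_min d0.
have t0 : 0 < t by rewrite divr_gt0.
have tm : t < Num.min d r by rewrite /t; lra.
have nt : `|t| = t by rewrite gtr0_norm.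
have [td tr] : t < d /\ t < r by move: tm; rewrite lt_min => /andP.
have zt : z + t *: u - z = t *: u by rewrite addrAC subrr add0r.
have ztr := hr t t0 tr.
have h1 : t * enorm u ^+ 2 <= kappa * dotv u (g (z + t *: u) - g z).
  have := g_mono ztr zr; rewrite zt enormZ nt dotvZr (dotvC _ u) exprMn => h.
  by rewrite -(ler_pM2l t0); move: h; rewrite expr2 -mulrA mulrCA -mulrA [kappa * _]mulrCA.
have h2 : dotv u (g (z + t *: u) - g z) <= t * dotv u (mxapp J u)
    + enorm u * (e / (kappa * (enorm u + 1)) * t).
  rewrite -lerBlDl -dotvZr -dotvBr; apply: le_trans (dotv_le_enorm _ _) _.
  by rewrite ler_wpM2l ?enorm_ge0//; have := hd t; rewrite nt; apply.
have h4 : kappa * (enorm u * (e / (kappa * (enorm u + 1)) * t)) <= e * t.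
  have u1 : 0 < enorm u + 1 by rewrite ltr_wpDl ?enorm_ge0.
  have -> : kappa * (enorm u * (e / (kappa * (enorm u + 1)) * t)) =
    (e * t) * (enorm u / (enorm u + 1)) by field; rewrite !gt_eqF.
  by rewrite ler_piMr ?mulr_ge0 ?ltW// ltr_pdivrMr// mul1r; lra.
rewrite -(ler_pM2l t0); apply: le_trans h1 _.
apply: le_trans (ler_wpM2l (ltW kappa0) h2) _.
by rewrite mulrDr [t * (_ + _)]mulrDr; apply: lerD; [rewrite mulrCA|rewrite [t * e]mulrC].
Qed.

(** The definition follows varying directions [uk]; Lipschitz continuity replaces them by the fixed
    [q] at a cost of [L] times their distance to [q]. *)
Lemma graph_deriv_approx x q w (e : R) : graph_deriv g x q w -> 0 < e -> enorm (x - xb) < rho ->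
  exists t, [/\ 0 < t, t < e, enorm (x + t *: q - xb) < rho &
    enorm (g (x + t *: q) - g x - t *: w) <= e * t].
Proof.
move=> [tk [qk [wk [tk0 [tkc [qkc [wkc gk]]]]]]] e0 xr.
pose r := e / (L + 1).
have L1 : 0 < L + 1 by have := L0; lra.
have r0 : 0 < r by rewrite divr_gt0.
have re : (L + 1) * r = e by rewrite mulrC divfK// gt_eqF.
pose s := (rho - enorm (x - xb)) / (enorm q + r + 1).
have qr1 : 0 < enorm q + r + 1 by have := enorm_ge0 q; lra.
have s0 : 0 < s by rewrite divr_gt0// subr_gt0.
have m0 : 0 < Num.min e s by rewrite lt_min e0.
have [N1 h1] := tkc _ m0; have [N2 h2] := qkc _ r0; have [N3 h3] := wkc _ r0.
pose k := maxn N1 (maxn N2 N3).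
have {h1} := h1 k (leq_maxl _ _).
have {h2} qq : enorm (qk k - q) < r.
  by apply: h2; rewrite (leq_trans (leq_maxl N2 N3))// leq_maxr.
have {h3} ww : enorm (wk k - w) < r.
  by apply: h3; rewrite (leq_trans (leq_maxr N2 N3))// leq_maxr.
have t0 := tk0 k; have gkk := gk k.
rewrite subr0 gtr0_norm// lt_min => /andP[te ts].
move: (tk k) (qk k) (wk k) t0 gkk qq ww te ts => t q' w' t0 gt qq ww te ts.
have tb (u : 'rV[R]_n) : enorm u <= enorm q + r -> enorm (x + t *: u - xb) < rho.
  move=> uq; have := enormD (x - xb) (t *: u); rewrite addrAC enormZ gtr0_norm//.
  move=> /le_lt_trans; apply; move: ts; rewrite ltr_pdivlMr//.
  have := ler_wpM2l (ltW t0) uq; lra.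
have qb : enorm (x + t *: q - xb) < rho by apply: tb; lra.
have q'b : enorm (x + t *: q' - xb) < rho.
  by apply: tb; have := enormD q (q' - q); rewrite addrC subrK; lra.
exists t; split=> //.
have -> : g (x + t *: q) - g x - t *: w =
    (g (x + t *: q) - g (x + t *: q')) + t *: (w' - w).
  by rewrite gt scalerBr opprD !addrA subrK.
apply: le_trans (enormD _ _) _; rewrite enormZ gtr0_norm//.
have := gL qb q'b.
have -> : x + t *: q - (x + t *: q') = - (t *: (q' - q)).
  by rewrite opprD addrACA subrr add0r -scalerBr -scalerN opprB.
rewrite enormN enormZ gtr0_norm// => h.
have h1 := ler_wpM2l (ltW L0) (ler_wpM2l (ltW t0) (ltW qq)).
have h2 := ler_wpM2l (ltW t0) (ltW ww).
by rewrite -re; lra.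
Qed.

(** The vector [u] is left free so that [x - xb] and [xb - x] give the two halves of part (i). *)
Lemma graph_deriv_hessian x q w u : enorm (x - xb) < rho / (n%:R + 1) ->
  graph_deriv g x q w ->
  exists A, gen_hessian g x A /\ enorm (u - q) <= kappa * enorm (w - mxapp A u).
Proof.
move=> xsmall hw.
have n1 : 0 < n%:R + 1 :> R by rewrite ltr_wpDl.
have nr : rho / (n%:R + 1) <= rho.
  by rewrite ler_pdivrMr// mulrDr mulr1 lerDr mulr_ge0// ltW.
have xr : enorm (x - xb) < rho := lt_le_trans xsmall nr.
pose a := rho / (n%:R + 1).
have a0 : 0 < a by rewrite divr_gt0.
have na : n%:R * a < rho.
  by rewrite /a mulrA ltr_pdivrMr// mulrC ltr_pM2l// ltrDl.
pose G z := g (vclamp xb a z).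
have GL z z' : enorm (G z - G z') <= L * enorm (z - z').
  have near y : enorm (vclamp xb a y - xb) < rho.
    by apply: le_lt_trans na; apply: vclamp_near; exact: ltW.
  apply: le_trans (gL (near z) (near z')) _.
  by rewrite ler_pM2l// vclamp_lip.
have Gg z : enorm (z - xb) <= a -> G z = g z by move=> za; rewrite /G vclamp_id.
(* The shear needs a coordinate direction, so dimension 0 is treated apart. *)
have [n0|[i0]] : n = 0%N \/ inhabited 'I_n.
  by case: (n) => [|m]; [left|right; exact: inhabits ord0].
  have all0 (v : 'rV[R]_n) : v = 0 by apply/rowP => i; have := ltn_ord i; rewrite {2}n0.
  exists 0; split; last by rewrite (all0 (u - q)) (all0 (w - _)) enorm0 mulr0.
  have cvg0 m (A : 'M[R]_m) : m = 0%N -> A = 0.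
    by move=> m0; apply/matrixP => i; have := ltn_ord i; rewrite {2}m0.
  exists (fun=> x), (fun=> 0); split; [|split].
  - by move=> e e0; exists 0%N => k _; rewrite subrr enorm0.
  - move=> k e e0; exists 1; split=> // z _.
    by rewrite (all0 (_ - mxapp _ _)) (all0 (z - x)) enorm0 mulr0.
  - move=> e e0; exists 0%N => k _; rewrite subrr /mxnorm big1 ?sqrtr0// => i _.
    by rewrite big1// => j _; rewrite mxE expr0n.
(* The mean value inequality yields [A] with [dotv p (A q) <= dotv p w]; as
   [dotv p (A p) >= |p|^2 / kappa], subtracting gives [|p|^2 / kappa <= dotv p (w - A u)]. *)
pose p := q - u.
have step k : exists zJ : 'rV[R]_n * 'M[R]_n, [/\ has_jacobian g zJ.1 zJ.2,
    enorm (zJ.1 - x) <= k.+1%:R^-1, enorm (zJ.1 - xb) < rho,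
    (forall v, enorm (mxapp zJ.2 v) <= L * enorm v) &
    dotv p (mxapp zJ.2 q) <= dotv p w + (enorm p + 1) * k.+1%:R^-1].
  have c0 : 0 < k.+1%:R^-1 :> R by rewrite invr_gt0.
  move: (k.+1%:R^-1) c0 => c c0.
  have gap : 0 < a - enorm (x - xb) by rewrite subr_gt0.
  (* The point [z] found below lies within [t * (enorm q + c)] of [x]; this choice keeps it within
     [c] of [x] and inside the ball where [G] is [g]. *)
  pose e := Num.min c (Num.min c (a - enorm (x - xb)) / (enorm q + c + 1)).
  have qc : 0 < enorm q + c + 1 by have := enorm_ge0 q; lra.
  have mm : 0 < Num.min c (a - enorm (x - xb)) by rewrite lt_min c0.
  have e0 : 0 < e by rewrite lt_min c0 divr_gt0.
  have [t [t0 te tr ht]] := graph_deriv_approx hw e0 xr.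
  have [tc ts] : t < c /\ t * (enorm q + c + 1) < Num.min c (a - enorm (x - xb)).
    by move: te; rewrite lt_min ltr_pdivlMr// => /andP.
  move: ts; rewrite lt_min => /andP[ts1 ts2].
  have ec : e <= c by rewrite ge_min lexx.
  have tc0 : 0 < t * c by rewrite mulr_gt0.
  (* The tolerance is proportional to [t], so that it survives division by [t] as the small quantity
     [c]. *)
  have [z [J [hJ zx pJ]]] := lipschitz_jacobian_mean_value x (t *: q) p i0 L0 GL tc0.
  rewrite enormZ gtr0_norm// in zx.
  have zxa : enorm (z - xb) < a by have := enorm_dist x z xb; lra.
  exists (z, J); split=> /=.
  - apply: has_jacobian_local (_ : 0 < a - enorm (z - xb)) _ hJ; first by rewrite subr_gt0.
    by move=> y yz; apply: Gg; have := enorm_dist z y xb; lra.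
  - lra.
  - exact: lt_le_trans zxa nr.
  - by move=> v; exact: has_jacobian_bound GL hJ.
  move: pJ; rewrite mxappZ dotvZr !Gg; [|exact: ltW|]; last first.
    have := enormD (x - xb) (t *: q); rewrite addrAC enormZ gtr0_norm//; nra.
  move=> pJ; rewrite -(ler_pM2l t0); apply: le_trans pJ _.
  have := dotv_le_enorm p (g (x + t *: q) - g x - t *: w).
  rewrite (dotvBr _ _ (t *: w)) dotvZr => h1.
  have h2 := ler_wpM2l (enorm_ge0 p) ht.
  have h3 := ler_wpM2l (enorm_ge0 p) (ler_wpM2r (ltW t0) ec); lra.
have [zJ hz] := choice step.
have [A [sub [subk JA]]] : exists A (sub : nat -> nat), (forall k, (k <= sub k)%N) /\
    mseq_cvg (fun k => (zJ (sub k)).2) A.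
  apply: (@jacobian_subsequence _ _ (fun k => (zJ k).2) L) => k i j.
  have [_ _ _ h _] := hz k; have := h (delta_mx 0 j); rewrite enorm_delta mulr1.
  apply: le_trans; apply: le_trans (coord_le_enorm _ i).
  by rewrite /mxapp -rowE !mxE.
have subinv k : (sub k).+1%:R^-1 <= k.+1%:R^-1 :> R.
  by rewrite lef_pV2 ?posrE// ler_nat ltnS.
exists A; split.
  exists (fun k => (zJ (sub k)).1), (fun k => (zJ (sub k)).2); split; last first.
    by split=> // k; have [] := hz (sub k).
  move=> e e0; have [m hm] := ltr_add_invr e0; rewrite add0r in hm.
  exists m => k mk; have [_ h _ _ _] := hz (sub k).
  apply: le_lt_trans h _; apply: le_lt_trans (subinv k) _; apply: le_lt_trans hm.
  by rewrite lef_pV2 ?posrE// ler_nat ltnS.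
have pA : dotv p (mxapp A q) <= dotv p w.
  apply: (seq_cvg_dotv_le (K := enorm p + 1) (mseq_cvg_mxapp q JA)) => k.
  have [_ _ _ _ h] := hz (sub k); apply: le_trans h _.
  by rewrite lerD2l ler_wpM2l// addr_ge0 ?enorm_ge0.
have pp : enorm p ^+ 2 <= kappa * dotv p (mxapp A p).
  rewrite -lerN2 mulrC -mulNr -dotvNl -ler_pdivlMr//.
  apply: (seq_cvg_dotv_le (K := 0) (mseq_cvg_mxapp p JA)) => k.
  have [h1 _ h2 _ _] := hz (sub k); rewrite mul0r addr0 ler_pdivlMr// dotvNl mulNr lerN2 mulrC.
  exact: has_jacobian_mono h2 h1.
have h : enorm p ^+ 2 <= kappa * (enorm p * enorm (w - mxapp A u)).
  apply: le_trans pp _; rewrite ler_pM2l//; apply: le_trans (dotv_le_enorm _ _).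
  by rewrite dotvBr {2}/p mxappB dotvBr lerB.
rewrite (enormBC u q) -[q - u]/p; have [->|p0] := eqVneq (enorm p) 0.
  by rewrite mulr_ge0 ?enorm_ge0// ltW.
have {}p0 : 0 < enorm p by rewrite lt_def p0 enorm_ge0.
by rewrite -(ler_pM2l p0) -expr2 mulrCA.
Qed.

Lemma strongly_monotone_dist x y : enorm (x - xb) < rho -> enorm (y - xb) < rho ->
  enorm (x - y) <= kappa * enorm (g x - g y).
Proof.
move=> xr yr; have [->|p0] := eqVneq (enorm (x - y)) 0.
  by rewrite mulr_ge0 ?enorm_ge0// ltW.
have {}p0 : 0 < enorm (x - y) by rewrite lt_def p0 enorm_ge0.
rewrite -(ler_pM2r p0) -expr2; apply: le_trans (g_mono xr yr) _.
by rewrite -mulrA ler_pM2l// dotv_le_enorm.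
Qed.

(** Along a ray the remainder of [H] is [o(t)], which forces every graphical derivative to be [H u].
    On two rays issued from the same [x] the value [g x] cancels, and dividing the distance bound by
    [t] gives the estimate. *)
Lemma semidiff_graph_deriv x : enorm (x - xb) < rho -> semidiff g x -> exists H : 'rV[R]_n -> 'rV[R]_n,
  (forall u w, graph_deriv g x u w <-> w = H u) /\
  forall u q, enorm (u - q) <= kappa * enorm (H u - H q).
Proof.
move=> xr [H [_ [Hh Hd]]]; exists H.
have ray u (e : R) : 0 < e -> exists d, 0 < d /\ forall t, 0 < t -> t < d ->
    enorm (g (x + t *: u) - g x - t *: H u) <= e * t.
  move=> e0; have u1 : 0 < enorm u + 1 by rewrite ltr_wpDl ?enorm_ge0.
  have e0' : 0 < e / (enorm u + 1) by rewrite divr_gt0.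
  have [d [d0 hd]] := Hd _ e0'; exists (d / (enorm u + 1)); split; first by rewrite divr_gt0.
  move=> t t0 td; have zt : x + t *: u - x = t *: u by rewrite addrAC subrr add0r.
  have tu : enorm (t *: u) <= t * (enorm u + 1).
    by rewrite enormZ gtr0_norm// ler_wpM2l ?lerDl// ltW.
  have := hd (x + t *: u); rewrite zt Hh// => h.
  apply: le_trans (h _) _; first by apply: le_lt_trans tu _; rewrite -ltr_pdivlMr.
  apply: le_trans (ler_wpM2l (ltW e0') tu) _.
  by rewrite mulrCA divfK ?gt_eqF// mulrC.
split=> [u w|u q].
  split=> [hw|->]; last first.
    exists (fun k => k.+1%:R^-1), (fun=> u),
      (fun k => k.+1%:R *: (g (x + k.+1%:R^-1 *: u) - g x)).
    split; [by move=> k; rewrite invr_gt0|split; [|split; [|split]]].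
    - move=> e e0; have [m hm] := ltr_add_invr e0; rewrite add0r in hm.
      exists m => k mk; rewrite subr0 ger0_norm ?invr_ge0//; apply: le_lt_trans hm.
      by rewrite lef_pV2 ?posrE// ler_nat ltnS.
    - by move=> e e0; exists 0%N => k _; rewrite subrr enorm0.
    - move=> e e0; have e2 : 0 < e / 2 by rewrite divr_gt0.
      have [d [d0 hd]] := ray u _ e2.
      have [m hm] := ltr_add_invr d0; rewrite add0r in hm.
      exists m => k mk; have t0 : 0 < k.+1%:R^-1 :> R by rewrite invr_gt0.
      have td : k.+1%:R^-1 < d.
        by apply: le_lt_trans hm; rewrite lef_pV2 ?posrE// ler_nat ltnS.
      have := hd _ t0 td; rewrite -(ler_pM2l (ltr0Sn R k)).
      rewrite -{1}(ger0_norm (ler0n R k.+1)) -enormZ scalerBr scalerA divff ?pnatr_eq0//.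
      rewrite scale1r mulrCA divff ?pnatr_eq0// mulr1 => /le_lt_trans; apply; lra.
    - by move=> k; rewrite scalerA mulVf ?pnatr_eq0// scale1r [g x + _]addrC subrK.
  apply/eqP; rewrite -subr_eq0 -enorm_eq0 eq_le enorm_ge0 andbT.
  apply/ler_addgt0Pr => e e0; have e2 : 0 < e / 2 by rewrite divr_gt0.
  have [d [d0 hd]] := ray u _ e2.
  have m0 : 0 < Num.min (e / 2) d by rewrite lt_min e2.
  have [t [t0 tm _ ht]] := graph_deriv_approx hw m0 xr.
  have [te td] : Num.min (e / 2) d <= e / 2 /\ t < d.
    by split; [rewrite ge_min lexx|move: tm; rewrite lt_min => /andP[]].
  have h1 := hd t t0 td; have h2 := le_trans ht (ler_wpM2r (ltW t0) te).
  rewrite add0r -(ler_pM2l t0) -{1}(gtr0_norm t0) -enormZ.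
  have := enormB (g (x + t *: u) - g x - t *: H u) (g (x + t *: u) - g x - t *: w).
  have -> : forall A B C : 'rV[R]_n, A - B - (A - C) = C - B.
    by move=> A B C; apply/rowP => i; rewrite !mxE; ring.
  by rewrite scalerBr; lra.
apply/ler_addgt0Pr => e e0; pose r := e / (2 * kappa).
have r0 : 0 < r by rewrite divr_gt0// mulr_gt0.
have re : 2 * kappa * r = e by rewrite mulrC divfK// gt_eqF// mulr_gt0.
have [d1 [d10 h1]] := ray u r r0; have [d2 [d20 h2]] := ray q r r0.
have [d3 [d30 h3]] := ball_ray u xr; have [d4 [d40 h4]] := ball_ray q xr.
pose m := Num.min (Num.min d1 d2) (Num.min d3 d4).
have m0 : 0 < m by rewrite !lt_min d10 d20 d30.
pose t := m / 2; have t0 : 0 < t by rewrite divr_gt0.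
have tm : t < m by rewrite /t; lra.
move: tm; rewrite !lt_min => /andP[/andP[t1 t2] /andP[t3 t4]].
have h5 := strongly_monotone_dist (h3 t t0 t3) (h4 t t0 t4).
rewrite opprD addrACA subrr add0r -scalerBr enormZ gtr0_norm// in h5.
rewrite -(ler_pM2l t0); apply: le_trans h5 _.
have -> : g (x + t *: u) - g (x + t *: q) = t *: (H u - H q) +
    ((g (x + t *: u) - g x - t *: H u) - (g (x + t *: q) - g x - t *: H q)).
  by apply/rowP => i; rewrite !mxE; ring.
have h6 := enormD (t *: (H u - H q))
  ((g (x + t *: u) - g x - t *: H u) - (g (x + t *: q) - g x - t *: H q)).
have h7 := enormB (g (x + t *: u) - g x - t *: H u) (g (x + t *: q) - g x - t *: H q).
rewrite enormZ gtr0_norm// in h6.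
have h8 := h1 t t0 t1; have h9 := h2 t t0 t2.
apply: le_trans (_ : kappa * (t * enorm (H u - H q) + 2 * (r * t)) <= _).
  by rewrite ler_pM2l//; lra.
by rewrite -re; lra.
Qed.

End Final.

Lemma sub_conv_hull (R : realType) (n : nat) (S : 'M[R]_n -> Prop) A : S A -> conv_hull S A.
Proof.
move=> SA; exists 1%N, (fun=> 1), (fun=> A); split=> //; split; first by rewrite big_ord1.
by split=> //; rewrite big_ord1 scale1r.
Qed.

Theorem theorem3p2 (R : realType) (n : nat) (phi : 'rV[R]_n -> R)
    (gphi : 'rV[R]_n -> 'rV[R]_n) (xb : 'rV[R]_n) (kappa : R)
    (hkappa : 0 < kappa)
    (hC11 : C11_near phi gphi xb)
    (htilt : tilt_stable phi xb kappa) :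
  let vb : 'rV[R]_n := 0 in
  (* (i), first part *)
  (exists delta : R, 0 < delta /\
    forall x v q : 'rV[R]_n, v = gphi x -> in_ball2 xb vb delta x v ->
      graph_deriv gphi x q (v - vb) ->
      exists A : 'M[R]_n, conv_hull (gen_hessian gphi x) A /\
        enorm (x - xb - q) <= kappa * enorm (gphi x - gphi xb - mxapp A (x - xb))) /\
  (* (i), second part *)
  (exists delta : R, 0 < delta /\
    forall x v q : 'rV[R]_n, v = gphi x -> in_ball2 xb vb delta x v ->
      graph_deriv gphi x q (vb - v) ->
      exists A : 'M[R]_n, conv_hull (gen_hessian gphi x) A /\
        enorm (x - xb + q) <= kappa * enorm (gphi x - gphi xb - mxapp A (x - xb))) /\
  (* (ii) *)
  ((exists r : R, 0 < r /\ forall z, enorm (z - xb) < r -> semidiff gphi z) ->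
   exists delta : R, 0 < delta /\
    forall x v q : 'rV[R]_n, v = gphi x -> in_ball2 xb vb delta x v ->
      graph_deriv gphi x q (v - vb) ->
      exists w : 'rV[R]_n,
        graph_deriv gphi x (x - xb) w /\
        (forall w', graph_deriv gphi x (x - xb) w' -> w' = w) /\
        enorm (x - xb - q) <= kappa * enorm (gphi x - gphi xb - w)).

Proof.
move=> vb.
have [gxb [rho [rho0 [L [L0 gLm]]]]] := tilt_strongly_monotone hkappa hC11 htilt.
have gL x y (xr : enorm (x - xb) < rho) (yr : enorm (y - xb) < rho) := (gLm x y xr yr).1.
have gm x y (xr : enorm (x - xb) < rho) (yr : enorm (y - xb) < rho) := (gLm x y xr yr).2.
have n1 : 0 < n%:R + 1 :> R by rewrite ltr_wpDl.
have a0 : 0 < rho / (n%:R + 1) by rewrite divr_gt0.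
(* [in_ball2] is a closed condition; halving the radius yields the strict inequality. *)
have near (d : R) x v : 0 < d -> in_ball2 xb vb (d / 2) x v -> enorm (x - xb) < d.
  move=> d0 hb; have d2 : 0 < d / 2 by rewrite divr_gt0.
  have : enorm (x - xb) ^+ 2 <= (d / 2) ^+ 2.
    by apply: le_trans hb; rewrite lerDl sqr_ge0.
  rewrite ler_pXn2r ?nnegrE ?enorm_ge0 ?(ltW d2)// => /le_lt_trans; apply.
  by rewrite ltr_pdivrMr// mulr_natr mulr2n ltrDl.
split; [|split].
- exists (rho / (n%:R + 1) / 2); split=> [|x v q vE /(near _ _ _ a0) xr hq].
    by rewrite divr_gt0.
  have [A [HA hA]] := graph_deriv_hessian hkappa rho0 L0 gL gm (x - xb) xr hq.
  exists A; split; last by rewrite gxb subr0 -vE; rewrite subr0 in hA.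
  exact: sub_conv_hull.
- exists (rho / (n%:R + 1) / 2); split=> [|x v q vE /(near _ _ _ a0) xr hq].
    by rewrite divr_gt0.
  (* With [u = xb - x] and [w = vb - v], the vectors inside both norms are the opposites of those in
     the goal. *)
  have [A [HA hA]] := graph_deriv_hessian hkappa rho0 L0 gL gm (xb - x) xr hq.
  exists A; split; first exact: sub_conv_hull.
  rewrite gxb subr0 -vE -enormN opprD opprB; apply: le_trans hA _.
  by rewrite ler_pM2l// -enormN opprB sub0r opprK addrC -(opprB x xb) mxappN.
- move=> [r [r0 hr]].
  have m0 : 0 < Num.min rho r by rewrite lt_min rho0.
  exists (Num.min rho r / 2); split=> [|x v q vE /(near _ _ _ m0)]; first by rewrite divr_gt0.
  rewrite lt_min => /andP[xr xr'] hq.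
  have [H [HE Hd]] := semidiff_graph_deriv hkappa L0 gL gm xr (hr x xr').
  exists (H (x - xb)); split; [exact/HE|split; first by move=> w' /HE].
  apply: le_trans (Hd _ _) _; rewrite ler_pM2l// enormBC.
  by move/HE: hq => <-; rewrite vE gxb.
Qed.
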